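(* Let $q$ be a prime power, let $\mathscr{S}_T$ be a tangent splash of $\ell_\infty$ in $\mathrm{PG}(2,q^3)$ with centre $T$, and let $[\mathscr{S}_T]$ be the corresponding set of spread planes in the Bruck-Bose representation in $\mathrm{PG}(6,q)$. If $\ell$ is a line (of $\Sigma_\infty$) meeting $q+1$ elements of $[\mathscr{S}_T]$, then $\ell$ lies in a unique cover plane of $[\mathscr{S}_T]$.
   Context: Bruck-Bose representation: $\Sigma_\infty$ is a hyperplane of $\mathrm{PG}(6,q)$ and $\mathcal{S}$ a regular 2-spread of $\Sigma_\infty\cong\mathrm{PG}(5,q)$; affine points of $\mathrm{PG}(2,q^3)$ are points of $\mathrm{PG}(6,q)\setminus\Sigma_\infty$, lines other than $\ell_\infty$ are 3-spaces not in $\Sigma_\infty$ containing a spread plane, and each $X\in\ell_\infty$ corresponds to a spread plane $[X]$; $[\mathscr{S}_T]=\{[X]:X\in\mathscr{S}_T\}$. An order-$q$-subplane is a subplane of order $q$; if it meets $\ell_\infty$ in exactly one point $T$, its tangent splash is the set of $q^2+1$ points of $\ell_\infty$ on extensions of its lines, with centre $T$. A cover plane of $[\mathscr{S}_T]$ is a plane of $\Sigma_\infty$ meeting every plane of $[\mathscr{S}_T]$.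
   Formalization: Uniqueness of the cover plane is claimed only for q > 2, since for q = 2 every line meeting 3 of the 5 planes of the splash lies in exactly 3 cover planes; existence is proved for every prime power q. *)

(* Defs.v *)
From HB Require Import structures.
From mathcomp Require Import all_boot all_order all_algebra all_field.

Set Implicit Arguments.
Unset Strict Implicit.
Unset Printing Implicit Defensive.

Import GRing.Theory.
Local Open Scope ring_scope.

Import VectorInternalTheory.
HB.instance Definition _ (K : finFieldType) (vT : vectType K) :=
  [Countable of {vspace vT} by <:].
HB.instance Definition _ (K : finFieldType) (vT : vectType K) :=
  [Finite of {vspace vT} by <:].

(* The subspaces of PG(n, K) are the linear subspaces of K^(n+1); a projective
   k-space is a linear subspace of dimension k + 1, incidence is (U <= W)%VS,
   and two projective subspaces meet iff their linear intersection is not 0. *)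
Notation PG n K := {vspace 'rV[K]_(n.+1)}.

Section ProjectiveSpace.

Variables (n : nat) (K : finFieldType).
Implicit Types U W : PG n K.

Definition kspaces (k : nat) : {set PG n K} := [set U | \dim U == k.+1].
Definition points := kspaces 0.
Definition lines := kspaces 1.
Definition planes := kspaces 2.
Definition solids := kspaces 3.
Definition hyperplanes : {set PG n K} := [set U | \dim U == n].

Definition meets U W : bool := (U :&: W != 0)%VS.

End ProjectiveSpace.

Arguments kspaces n K k : clear implicits.
Arguments points {n K}.
Arguments lines {n K}.
Arguments planes {n K}.
Arguments solids {n K}.
Arguments hyperplanes {n K}.

Section Subplane.

Variable K : finFieldType.
Implicit Types (B : {set PG 2 K}) (T l X : PG 2 K).

Definition points_on B l : {set PG 2 K} := [set P in B | (P <= l)%VS].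

Definition sublines B : {set PG 2 K} := [set m in lines | (1 < #|points_on B m|)%N].

Definition noncollinear (P Q R : PG 2 K) : Prop :=
  ~~ [exists m in lines, [&& (P <= m)%VS, (Q <= m)%VS & (R <= m)%VS]].

(* B and its extended lines, with the incidence of PG(2, K), form a projective
   plane of order q; that two points of B are on exactly one of these lines is
   inherited from PG(2, K). *)
Definition order_subplane (q : nat) B : Prop :=
  [/\ B \subset points,
      {in sublines B &, forall l m, l != m ->
         exists2 P, P \in B & (P <= l)%VS && (P <= m)%VS},
      exists P Q R S,
        [/\ [/\ P \in B, Q \in B, R \in B & S \in B],
            noncollinear P Q R, noncollinear P Q S,
            noncollinear P R S & noncollinear Q R S]
    & {in sublines B, forall m, #|points_on B m| = q.+1}].

Definition splash (linf : PG 2 K) B : {set PG 2 K} :=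
  [set X in points | (X <= linf)%VS && [exists m in sublines B, (X <= m)%VS]].

Definition tangent_splash (q : nat) (linf T : PG 2 K) (ST : {set PG 2 K}) :
    Prop :=
  exists B, [/\ order_subplane q B, points_on B linf = [set T]
              & ST = splash linf B].

End Subplane.

Section Spread.

Variables (n : nat) (F : finFieldType) (Sigma : PG n F).
Implicit Types (A R S : {set PG n F}) (P : PG n F).

Definition planes_of : {set PG n F} := [set U in planes | (U <= Sigma)%VS].

Definition is_2spread S : Prop :=
  S \subset planes_of /\
  {in points, forall X, (X <= Sigma)%VS ->
     #|[set U in S | (X <= U)%VS]| = 1%N}.

Definition is_2regulus R : Prop :=
  [/\ R \subset planes_of,
      #|R| = #|F|.+1,
      {in R &, forall U W, U != W -> ~~ meets U W}
    & {in lines, forall l, (l <= Sigma)%VS ->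
         (2 < #|[set U in R | meets l U]|)%N -> {in R, forall U, meets l U}}].

Definition regular_2spread S : Prop :=
  is_2spread S /\
  forall R, is_2regulus R -> (2 < #|R :&: S|)%N -> R \subset S.

Definition cover_plane A P : Prop :=
  P \in planes_of /\ {in A, forall U, meets P U}.

End Spread.

Section BruckBose.

Variables (F L : finFieldType) (Sigma : PG 6 F) (S : {set PG 6 F}).

(* In the plane with these points and lines, incidence is containment of
   subspaces, and Sigma plays the role of the line at infinity. *)
Definition bb_points : {set PG 6 F} :=
  [set U in points | ~~ (U <= Sigma)%VS] :|: S.

Definition bb_lines : {set PG 6 F} :=
  Sigma |: [set U in solids | ~~ (U <= Sigma)%VS
                              && [exists A in S, (A <= U)%VS]].

(* phi P and psi l are the subspaces of PG(6, F) representing the point P and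
   the line l of PG(2, L); so phi X is the spread plane [X] for X on linf. *)
Definition bruck_bose (linf : PG 2 L) (phi psi : PG 2 L -> PG 6 F) : Prop :=
  [/\ {in points &, injective phi} /\ [set phi P | P in points] = bb_points,
      {in lines &, injective psi} /\ [set psi l | l in lines] = bb_lines,
      {in points & lines, forall P l, (phi P <= psi l)%VS = (P <= l)%VS}
    & psi linf = Sigma].

End BruckBose.

(* Main.v *)
Require Import Defs.
From HB Require Import structures.
From mathcomp Require Import all_boot all_order all_algebra all_field.
From mathcomp Require Import ring.

(* With an affine origin chosen, a Bruck-Bose representation is a bijection g
   from the vectors of linf, that is from L^2, to the vectors of Sigma. It is
   additive and semilinear for an embedding of F in L, and spread planes are the
   images of the one-dimensional L-subspaces.
   A frame of the subplane at T puts its points on F-rational coordinates, and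
   the splash becomes T = (1, 0) together with the points (w, 1) for w in the
   F-plane W = F + F eta of L.

   If the q + 1 points of l are all on splash elements and l meets [T], then l is
   spanned by (u t, 0) and (w t, t) with u, w in W, and lies in the cover plane
   t (W x F). Both the absence of other lines l and the uniqueness of the cover
   plane for q > 2 come down to 1, r, r^2 being independent over F for r in L
   outside F, because L has no subfield of order q^2. For q = 2 there are lines
   missing [T], which need a separate construction. *)

Set Implicit Arguments.
Unset Strict Implicit.
Unset Printing Implicit Defensive.

Import GRing.Theory.
Local Open Scope ring_scope.

(** * Finite fields: elements fixed by a power map *)

(** Multiplication by a nonzero [x] permutes the nonzero elements of [E], so their product [P]
    equals x^(#|E| - 1) P, and [P] cancels. Closure under products suffices, which suits sets not
    yet known to be subfields. *)
Lemma expf_card_stable (L : finFieldType) (E : {set L}) :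
    0 \in E -> {in E &, forall x y, x * y \in E} ->
  {in E, forall x, x ^+ #|E| = x}.
Proof.
move=> E0 Em x xE; rewrite (cardsD1 0) E0 add1n.
have [->|x0] := eqVneq x 0; first by rewrite expr0n.
pose P := \prod_(y in E :\ 0) y.
have P0 : P != 0 by apply/prodf_neq0 => y /setD1P[].
have xI : injective ( *%R x) by apply: mulfI.
have Eim : [set x * y | y in E :\ 0] = E :\ 0.
  apply/eqP; rewrite eqEcard (card_imset _ xI) leqnn andbT.
  apply/subsetP => _ /imsetP[y /setD1P[y0 yE] ->].
  by rewrite !inE mulf_neq0 //= Em.
suff xP : P = x ^+ #|E :\ 0| * P.
  by rewrite exprS -(mulIf P0 (etrans (mul1r P) xP)) mulr1.
rewrite -prodr_const {2}/P -big_split /= /P -{1}Eim big_imset //.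
by move=> ? ? _ _ /xI.
Qed.

Section CubicExtension.

Variables (F L : finFieldType) (s : {rmorphism F -> L}).

(** The image of [s] already supplies #|F| roots of X^#|F| - X; one more would exceed the degree. *)
Lemma mem_rmorph_fixed (x : L) : x ^+ #|F| = x -> x \in codom s.
Proof.
move=> xq; apply/negPn/negP => xF.
have F1 := finNzRing_gt1 F.
pose p : {poly L} := 'X^#|F| - 'X.
have sp : size p = #|F|.+1.
  by rewrite size_polyDl size_polyXn // size_polyN size_polyX.
have := @max_poly_roots _ p (x :: codom s).
rewrite -size_poly_eq0 sp /= xF map_inj_uniq ?enum_uniq; last exact: fmorph_inj.
rewrite size_codom ltnn => H; suff: false by [].
apply: H => //; rewrite rootE !hornerE /= xq subrr eqxx /=.
apply/allP => _ /codomP[a ->].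
by rewrite rootE !hornerE /= -rmorphXn expf_card subrr.
Qed.

Lemma rmorph_indep2 (r : L) (a b : F) :
  r \notin codom s -> s a + s b * r = 0 -> a = 0 /\ b = 0.
Proof.
move=> rF; have [->|b0] := eqVneq b 0.
  by rewrite rmorph0 mul0r addr0 => /eqP; rewrite fmorph_eq0 => /eqP.
move=> /eqP; rewrite addr_eq0 => /eqP E; case/negP: rF; apply/codomP.
exists (- (a / b)); rewrite rmorphN fmorph_div E mulNr opprK mulrC mulKf //.
by rewrite fmorph_eq0.
Qed.

Hypothesis cardL : #|L| = (#|F| ^ 3)%N.

(** A nonzero [c] makes [r] quadratic over F, so F + F r is closed under products and has q^2
    elements, where q = #|F|. Then r^(q^2) = r, and with r^(q^3) = r in L this gives r^q = r, which
    puts [r] in F. *)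
Lemma rmorph_indep3 (r : L) (a b c : F) :
  r \notin codom s -> s a + s b * r + s c * r ^+ 2 = 0 -> c = 0.
Proof.
move=> rF H; apply/eqP/negP => /negP c0.
have sc0 : s c != 0 by rewrite fmorph_eq0.
have r2 : r * r = - (s (a / c) + s (b / c) * r).
  rewrite !fmorph_div; apply: (mulfI sc0); rewrite -expr2.
  have -> : s c * r ^+ 2 = - (s a + s b * r) by apply/eqP; rewrite -addr_eq0 addrC H.
  by field.
pose f (u : F * F) := s u.1 + s u.2 * r.
have fI : injective f.
  move=> [x1 y1] [x2 y2] /eqP; rewrite -subr_eq0 => /eqP E.
  have [] : x1 - x2 = 0 /\ y1 - y2 = 0.
    by apply: (@rmorph_indep2 r) => //; rewrite -E /f /= !rmorphB; ring.
  by move=> /eqP; rewrite subr_eq0 => /eqP-> /eqP; rewrite subr_eq0 => /eqP->.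
pose E := [set f u | u : F * F].
have cE : #|E| = (#|F| ^ 2)%N by rewrite card_imset // card_prod.
have rE : r ^+ (#|F| ^ 2)%N = r.
  rewrite -cE; apply: expf_card_stable.
  - by apply/imsetP; exists (0, 0) => //; rewrite /f /= !rmorph0 mul0r addr0.
  - move=> _ _ /imsetP[[x1 y1] _ ->] /imsetP[[x2 y2] _ ->]; apply/imsetP.
    exists (x1 * x2 - y1 * y2 * (a / c), x1 * y2 + x2 * y1 - y1 * y2 * (b / c)) => //.
    rewrite /f /=.
    transitivity (s x1 * s x2 + (s x1 * s y2 + s x2 * s y1) * r + s y1 * s y2 * (r * r)).
      by ring.
    by rewrite r2 !(rmorphB, rmorphD, rmorphM); ring.
  - by apply/imsetP; exists (0, 1) => //; rewrite /f /= rmorph0 rmorph1 mul1r add0r.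
case/negP: rF; apply: mem_rmorph_fixed.
by rewrite -[in LHS]rE -exprM -expnSr -cardL expf_card.
Qed.

End CubicExtension.

(** * Cover planes in coordinates *)

Section AddLine.

Variables (K : fieldType) (vT : vectType K).
Implicit Types (U W : {vspace vT}) (v : vT).

Lemma dimv_add_line U v : v \notin U -> \dim (U + <[v]>) = (\dim U).+1.
Proof.
move=> vU; have v0 : v != 0 by apply: contraNneq vU => ->; rewrite mem0v.
rewrite dimv_disjoint_sum ?dim_vline ?v0 ?addn1 //.
apply/eqP; rewrite -subv0; apply/subvP => x /memv_capP[xU /vlineP[k xk]].
rewrite memv0 xk scaler_eq0 (negPf v0) orbF; apply: contraNT vU => k0.
by rewrite -(scalerK k0 v) -xk memvZ.
Qed.

Lemma addv_line_eq U W v :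
  (U <= W)%VS -> v \in W -> v \notin U -> \dim W = (\dim U).+1 ->
  W = (U + <[v]>)%VS.
Proof.
move=> UW vW vU dW; apply/esym/eqP.
by rewrite eqEdim dimv_add_line // dW leqnn andbT subv_add UW -memvE.
Qed.

Lemma memv_notin_lt U W : (\dim U < \dim W)%N -> exists2 v, v \in W & v \notin U.
Proof. by rewrite ltnNge => H; apply/subvPn; apply: contra H; apply: dimvS. Qed.

Lemma memv_line2 v w x :
  x \in (<[v]> + <[w]>)%VS -> exists a b, x = a *: v + b *: w.
Proof.
by case/memv_addP => _ /vlineP[a ->] [_ /vlineP[b ->] ->]; exists a, b.
Qed.

End AddLine.

Lemma card_gt2_exists (F : finNzRingType) :
  (2 < #|F|)%N -> exists2 c : F, c != 0 & c != 1.
Proof.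
move=> F2; have [c /norP[c0 c1]|F01] := pickP (fun c : F => ~~ [|| c == 0 | c == 1]).
  by exists c.
suff: (#|F| <= 2)%N by rewrite leqNgt F2.
have <- : #|[set 0; 1 : F]| = 2%N by rewrite cards2 eq_sym oner_neq0.
by apply/subset_leq_card/subsetP => c _; have := F01 c; rewrite !inE; case: orP.
Qed.

Section CoverPlanes.

Variables (F L : finFieldType) (s : {rmorphism F -> L}).
Hypothesis cardL : #|L| = (#|F| ^ 3)%N.

Variable eta : L.
Hypothesis etaF : eta \notin codom s.

(* A vector (x, t) of L^2 with t != 0 lies on the spread plane of slope x / t,
   the others lie on the plane at infinity, which represents the centre. Up to
   coordinates the splash consists of the centre and the slopes in F + F eta. *)
Definition slope (w : L) : Prop := exists a b, w = s a + s b * eta.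

Lemma slopeD x y : slope x -> slope y -> slope (x + y).
Proof.
move=> [a [b ->]] [c [d ->]]; exists (a + c), (b + d).
by rewrite !rmorphD; ring.
Qed.

Lemma slopeZ a x : slope x -> slope (s a * x).
Proof. by move=> [c [d ->]]; exists (a * c), (a * d); rewrite !rmorphM; ring. Qed.

Lemma slopeB x y : slope x -> slope y -> slope (x - y).
Proof.
move=> xW /(slopeZ (-1)); rewrite rmorphN rmorph1 mulN1r; exact: slopeD.
Qed.

Lemma slope1 : slope 1.
Proof. by exists 1, 0; rewrite rmorph0 rmorph1 mul0r addr0. Qed.

Lemma slope_eta : slope eta.
Proof. by exists 0, 1; rewrite rmorph0 rmorph1 mul1r add0r. Qed.

(** In the coordinates with respect to 1 and [eta], the determinant [D] of [u], [v] vanishes only if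
    [v / u] lies in F; otherwise Cramer's rule gives the coefficients. *)
Lemma slope_span u v w : slope u -> slope v -> slope w -> u != 0 ->
  v / u \notin codom s -> exists a b, w = s a * u + s b * v.
Proof.
move=> [u1 [u2 uE]] [v1 [v2 vE]] [w1 [w2 wE]] u0 vu.
pose D := u1 * v2 - u2 * v1.
have D0 : D != 0.
  apply: contraNneq vu => D0; apply/codomP.
  have sD : s u1 * s v2 = s u2 * s v1.
    by apply/eqP; rewrite -subr_eq0 -!rmorphM -rmorphB -/D D0 rmorph0.
  have [u10|u10] := eqVneq u1 0; last first.
    exists (v1 / u1); apply: (mulIf u0); rewrite divfK // fmorph_div uE vE.
    have su1 : s u1 != 0 by rewrite fmorph_eq0.
    apply: (mulfI su1); transitivity (s u1 * s v1 + (s u1 * s v2) * eta).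
      by ring.
    by rewrite sD; field.
  have su2 : s u2 != 0.
    by apply: contraNneq u0 => u20; rewrite uE u20 u10 rmorph0 mul0r addr0.
  exists (v2 / u2); apply: (mulIf u0); rewrite divfK // fmorph_div uE vE.
  apply: (mulfI su2); transitivity (s u2 * s v1 + s u2 * s v2 * eta); first by ring.
  by rewrite -sD; field.
have sD : s D != 0 by rewrite fmorph_eq0.
exists ((w1 * v2 - w2 * v1) / D), ((u1 * w2 - u2 * w1) / D).
rewrite wE uE vE !fmorph_div; apply: (mulfI sD).
transitivity (s (w1 * v2 - w2 * v1) * (s u1 + s u2 * eta)
   + s (u1 * w2 - u2 * w1) * (s v1 + s v2 * eta)); last by field.
by rewrite /D !(rmorphB, rmorphM); ring.
Qed.

Variables (V : vectType F) (G : L -> L -> V) (Sg : {vspace V}).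
Hypothesis GD : forall x t x' t', G (x + x') (t + t') = G x t + G x' t'.
Hypothesis GZ : forall a x t, G (s a * x) (s a * t) = a *: G x t.
Hypothesis G_inj : forall x t x' t', G x t = G x' t' -> x = x' /\ t = t'.
Hypothesis G_mem : forall x t, G x t \in Sg.
Hypothesis G_onto : forall v, v \in Sg -> exists x t, v = G x t.

(** The spread plane of slope [w] consists of the vectors [G (w * c) c], that of the centre of the
    vectors [G c 0]; so meeting it in a nonzero vector amounts to a nonzero [c] in L. *)
Definition covers (P : {vspace V}) : Prop :=
  (exists2 c, c != 0 & G c 0 \in P) /\
  (forall w, slope w -> exists2 c, c != 0 & G (w * c) c \in P).

Lemma G00 : G 0 0 = 0.
Proof. by have := GZ 0 0 0; rewrite rmorph0 !mul0r scale0r. Qed.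

Lemma GB x t x' t' : G (x - x') (t - t') = G x t - G x' t'.
Proof.
by rewrite -mulN1r -(mulN1r t') -(rmorph1 s) -rmorphN GD GZ scaleN1r.
Qed.

(** These are the vectors [G (w * t) (s b * t)] with [w] a slope and [b] in F, that is t (W x F). *)
Definition standard_cover (t : L) : {vspace V} :=
  (<[G t 0%R]> + <[G (eta * t)%R 0%R]> + <[G 0%R t]>)%VS.

Lemma mem_standard_cover t w b :
  slope w -> G (w * t) (s b * t) \in standard_cover t.
Proof.
move=> [a1 [a2 ->]].
have -> : G ((s a1 + s a2 * eta) * t) (s b * t)
   = a1 *: G t 0 + a2 *: G (eta * t) 0 + b *: G 0 t.
  by rewrite -!GZ -!GD; congr (G _ _); ring.
by rewrite !memv_add // memvZ // memv_line.
Qed.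

Lemma dim_standard_cover t : t != 0 -> \dim (standard_cover t) = 3.
Proof.
move=> t0; rewrite /standard_cover !dimv_add_line.
- rewrite dim_vline; suff -> : G t 0 != 0 by [].
  by apply: contra_neq t0; rewrite -G00 => /G_inj[].
- apply: contra etaF => /vlineP[k]; rewrite -GZ => /G_inj[/(mulIf t0)-> _].
  exact: codom_f.
- apply/negP => /memv_line2[a [b]]; rewrite -!GZ -GD => /G_inj[_].
  by rewrite !mulr0 addr0; apply/eqP.
Qed.

Lemma covers_standard_cover t : t != 0 -> covers (standard_cover t).
Proof.
move=> t0; split.
  exists t => //; rewrite -[X in G X _](mul1r) -(mul0r t) -(rmorph0 s).
  exact/mem_standard_cover/slope1.
move=> w wW; exists t => //; rewrite -[X in G _ X]mul1r -(rmorph1 s).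
exact: mem_standard_cover.
Qed.

(** Dividing by [t] and shearing the slope [w] to 0 turns the given vectors into (u, 0) and (0, 1);
    a third generator of [P] becomes (X, S). If [S] lies in F, then [P] contains (X, 0), and
    covering all slopes forces W x 0 into it. Otherwise three slopes give a quadratic relation over
    F that is impossible. *)
Lemma covers_sub_standard (P : {vspace V}) t u w :
    (2 < #|F|)%N -> t != 0 -> u != 0 -> slope u -> slope w ->
    (P <= Sg)%VS -> \dim P = 3 -> covers P ->
    G (u * t) 0 \in P -> G (w * t) t \in P ->
  (standard_cover t <= P)%VS.
Proof.
move=> F2 t0 u0 uW wW PSg dP [_ covP] uP wP.
pose l : {vspace V} := (<[G (u * t)%R 0%R]> + <[G (w * t)%R t]>)%VS.
have dl : \dim l = 2.
  rewrite dimv_add_line ?dim_vline.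
    suff -> : G (u * t) 0 != 0 by [].
    have ut0 : u * t != 0 by rewrite mulf_neq0.
    by apply: contra_neq ut0; rewrite -G00 => /G_inj[].
  apply/negP => /vlineP[k]; rewrite -GZ => /G_inj[_ /eqP].
  by rewrite mulr0 (negPf t0).
have lP : (l <= P)%VS by rewrite subv_add -!memvE uP wP.
have [|z zP zl] := @memv_notin_lt _ _ l P; first by rewrite dl dP.
have [x [r zE]] := G_onto (subvP PSg _ zP).
have PE : P = (l + <[z]>)%VS by apply: addv_line_eq; rewrite ?dl.
pose S := r / t; pose X := x / t - w * S.
have xE : x = (X + w * S) * t by rewrite /X; field.
have rE : r = S * t by rewrite /S divfK.
(* A vector of [P] of slope [v + w] is expanded in the three generators: its second coordinate gives
   the factor b + d S, its first the equation. *)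
have key v : slope v -> exists a b d,
    s b + s d * S != 0 /\ v * (s b + s d * S) = s a * u + s d * X.
  move=> vW; have [c c0] := covP _ (slopeD vW wW).
  rewrite PE => /memv_addP[_ /memv_line2[a [b ->]] [_ /vlineP[d ->]]].
  rewrite zE -!GZ -!GD => /G_inj[E1 E2]; exists a, b, d.
  have cE : c = (s b + s d * S) * t by rewrite E2 rE; ring.
  have bd0 : s b + s d * S != 0 by apply: contraNneq c0 => E; rewrite cE E mul0r.
  split=> //; apply: (mulIf t0); move: E1; rewrite cE xE => E1.
  transitivity ((v + w) * ((s b + s d * S) * t) - w * ((s b + s d * S) * t)).
    by ring.
  by rewrite E1; ring.
suff Wt v : slope v -> G (v * t) 0 \in P.
  rewrite !subv_add -!memvE Wt ?andbT; last exact: slope_eta.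
  rewrite -[X in G X _]mul1r Wt /=; last exact: slope1.
  by have := memvB wP (Wt _ wW); rewrite -GB subrr subr0.
move=> vW; have [/codomP[s0 SE]|SF] := boolP (S \in codom s).
  have [a [b [d [bd0 E]]]] := key v vW.
  have XP : G (X * t) 0 \in P.
    have -> : G (X * t) 0 = z - s0 *: G (w * t) t.
      by rewrite zE xE rE -GZ -GB -SE; congr (G _ _); ring.
    by rewrite memvB // memvZ.
  have bdE : s b + s d * S = s (b + d * s0) by rewrite SE rmorphD rmorphM.
  rewrite bdE in bd0 E.
  have -> : G (v * t) 0 = (a / (b + d * s0)) *: G (u * t) 0
     + (d / (b + d * s0)) *: G (X * t) 0.
    rewrite -!GZ -GD !mulr0 addr0; congr (G _ _).
    apply: (mulIf bd0); transitivity (v * s (b + d * s0) * t); first by ring.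
    by rewrite E !fmorph_div; field; rewrite -rmorphM -rmorphD.
  by rewrite memvD // memvZ.
have [c c0 c1] := card_gt2_exists F2.
have [th thW thF] : exists2 th, slope th & th / u \notin codom s.
  have [/codomP[a aE]|] := boolP (1 / u \in codom s); last first.
    by exists 1 => //; apply: slope1.
  exists eta; first exact: slope_eta.
  apply: contra etaF => /codomP[b bE]; apply/codomP; exists (b / a).
  by rewrite fmorph_div -aE -bE div1r invrK divfK.
(* For a slope outside F u the coefficient [d] is nonzero, as otherwise b v1 = a u with b nonzero.
   Dividing by [d] gives [X] the coefficient 1, so that [X] cancels in differences. *)
have key1 v1 : slope v1 -> v1 / u \notin codom s ->
    exists a b, v1 * S = X + s a * u + s b * v1.
  move=> v1W v1F; have [a [b [d [bd0 E]]]] := key v1 v1W.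
  have [d0|d0] := eqVneq d 0.
    rewrite d0 rmorph0 !mul0r !addr0 in E bd0; case/negP: v1F; apply/codomP.
    exists (a / b); rewrite fmorph_div; apply: (mulIf u0); apply: (mulIf bd0).
    by rewrite divfK // E; field.
  have sd0 : s d != 0 by rewrite fmorph_eq0.
  exists (a / d), (- (b / d)); apply: (mulfI sd0); rewrite rmorphN !fmorph_div.
  transitivity (v1 * (s b + s d * S) - s b * v1); first by ring.
  by rewrite E; field.
have [a1 [b1 E1]] := key1 th thW thF.
have [||a2 [b2 E2]] := key1 (th + u).
- exact: slopeD.
- apply: contra thF => /codomP[a aE]; apply/codomP; exists (a - 1).
  by rewrite rmorphB rmorph1 -aE; field.
have [||a3 [b3 E3]] := key1 (s c * th).
- exact: slopeZ.
- apply: contra thF => /codomP[a aE]; apply/codomP; exists (a / c).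
  by rewrite fmorph_div -aE; field; rewrite u0 fmorph_eq0 c0.
pose rho := th / u.
(* The relations for [th + u] and [th] differ by one that puts u S in the F-span of [u] and [th]. *)
have [al [be SE]] : exists al be, S = s al + s be * rho.
  exists (a2 - a1 + b2), (b2 - b1).
  apply: (mulIf u0); rewrite /rho !(rmorphD, rmorphB).
  transitivity ((th + u) * S - th * S); first by ring.
  by rewrite E2 E1; field.
(* The relations for [s c * th] and [th], subtracted and divided by [u], give a quadratic relation
   for [rho] with leading coefficient (c - 1) be. *)
have be0 : (c - 1) * be = 0.
  apply: (@rmorph_indep3 _ _ s cardL rho (a1 - a3) ((c - 1) * al - (b3 * c - b1))) => //.
  rewrite !(rmorphB, rmorphM, rmorph1).
  transitivity ((s c - 1) * rho * (s al + s be * rho) + (s a1 - s a3) - (s b3 * s c - s b1) * rho).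
    by ring.
  rewrite -SE; apply: (mulIf u0).
  transitivity (s c * th * S - th * S + (s a1 - s a3) * u - (s b3 * s c - s b1) * th).
    by rewrite /rho; field.
  by rewrite E3 E1; ring.
case/negP: SF; apply/codomP; exists al; rewrite SE.
move/eqP: be0; rewrite mulf_eq0 subr_eq0 (negPf c1) => /eqP->.
by rewrite rmorph0 mul0r addr0.
Qed.

Variable l : {vspace V}.
Hypothesis l_dim : \dim l = 2.
Hypothesis l_sub : (l <= Sg)%VS.
Hypothesis l_slope : forall x t, G x t \in l -> t != 0 -> slope (x / t).
Hypothesis l_scattered : forall x t x' t', G x t \in l -> G x' t' \in l ->
  G x t != 0 -> x * t' = x' * t -> G x' t' \in <[G x t]>%VS.

(** If (y, 0) and (x, t) span [l], then [t] is nonzero because [l] has only one point at infinity.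
    Both x / t and (y + x) / t are slopes, hence so is their difference u = y / t. *)
Lemma line_through_infinity y :
  y != 0 -> G y 0 \in l -> exists t u w,
    [/\ t != 0, u != 0, slope u & slope w] /\ l = (<[G (u * t)%R 0%R]> + <[G (w * t)%R t]>)%VS.
Proof.
move=> y0 yl; have Gy0 : G y 0 != 0 by apply: contra_neq y0; rewrite -G00 => /G_inj[].
have [|v vl vy] := @memv_notin_lt _ _ <[G y 0%R]>%VS l.
  by rewrite l_dim dim_vline Gy0.
have [x [t vE]] := G_onto (subvP l_sub _ vl); rewrite {}vE in vl vy.
have t0 : t != 0.
  by apply: contraNneq vy => tE; apply: l_scattered => //; rewrite tE !mulr0.
have xW := l_slope vl t0.
have yxW : slope ((y + x) / t).
  by apply: l_slope => //; rewrite -[t]add0r GD memvD.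
exists t, (y / t), (x / t); split.
  split => //; first by rewrite mulf_neq0 ?invr_eq0.
  by have := slopeB yxW xW; rewrite -mulrBl addrK.
by rewrite !divfK //; apply: addv_line_eq; rewrite ?l_dim ?dim_vline ?Gy0 -?memvE.
Qed.

(* Over the field of two elements the splash may also be met by lines missing
   its centre: the points of such a line have three of the four slopes, and
   adding a point on the centre takes care of the fourth. *)
Lemma line_off_infinity :
    (forall y, G y 0 \in l -> y = 0) ->
  (#|F| <= 2)%N /\ exists P, [/\ \dim P = 3, (P <= Sg)%VS, covers P & (l <= P)%VS].
Proof.
move=> l0.
have lt0 x t : G x t \in l -> G x t != 0 -> t != 0.
  by move=> xl; apply: contra_neq => tE; move: xl; rewrite tE => /l0->; rewrite G00.
have [|v1 v1l] := @memv_notin_lt _ _ 0%VS l; first by rewrite l_dim dimv0.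
rewrite memv0 => v10; have [|v2 v2l v12] := @memv_notin_lt _ _ <[v1]>%VS l.
  by rewrite l_dim dim_vline v10.
have v20 : v2 != 0 by apply: contraNneq v12 => ->; rewrite mem0v.
have [x1 [t1 v1E]] := G_onto (subvP l_sub _ v1l).
have [x2 [t2 v2E]] := G_onto (subvP l_sub _ v2l).
rewrite {v1}v1E {v2}v2E in v1l v10 v2l v20 v12.
have t10 := lt0 _ _ v1l v10; have t20 := lt0 _ _ v2l v20.
pose r := t1 / t2; pose w1 := x1 / t1; pose w2 := x2 / t2.
have t1E : t1 = r * t2 by rewrite /r divfK.
have x1E : x1 = w1 * t1 by rewrite /w1 divfK.
have x2E : x2 = w2 * t2 by rewrite /w2 divfK.
(* For [r] in F some combination of the generators would have second coordinate 0, hence vanish by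
   [l0], and the generators would be dependent. *)
have rF : r \notin codom s.
  apply: contra v12 => /codomP[a rE].
  have a0 : a != 0.
    by apply: contraNneq t10 => a0; rewrite t1E rE a0 rmorph0 mul0r.
  have : G (x1 - s a * x2) 0 \in l.
    have -> : 0 = t1 - s a * t2 by rewrite t1E rE subrr.
    by rewrite GB GZ memvB // memvZ.
  move/l0/eqP; rewrite subr_eq0 => /eqP xE.
  by rewrite xE t1E rE GZ -[X in X \in _](scalerK a0) memvZ // memv_line.
have w1W : slope w1 by apply: l_slope.
have w2W : slope w2 by apply: l_slope.
pose u := w2 - w1; have uW : slope u by apply: slopeB.
have u0 : u != 0.
  apply: contraNneq v12 => /eqP; rewrite subr_eq0 => /eqP wE.
  by apply: l_scattered => //; rewrite x1E x2E wE; ring.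
have rc0 (c : F) : c != 0 -> r + s c != 0.
  move=> c0; apply: contraNneq rF => /eqP; rewrite addr_eq0 => /eqP->.
  by apply/codomP; exists (- c); rewrite rmorphN.
(* The first generator plus [c] times the second has slope w1 + uc with uc = c u / (r + c). *)
have uc (c : F) : c != 0 -> exists2 uc, slope uc & uc * (r + s c) = s c * u
    /\ x1 + s c * x2 = (w1 + uc) * (t1 + s c * t2).
  move=> c0.
  have tc0 : t1 + s c * t2 != 0 by rewrite t1E -mulrDl mulf_neq0 // rc0.
  exists ((x1 + s c * x2) / (t1 + s c * t2) - w1).
    by apply: slopeB => //; apply: l_slope => //; rewrite GD GZ memvD // memvZ.
  by rewrite x1E x2E /u t1E; split; field; rewrite -t1E.
have [u1 u1W [u1E u1x]] := uc 1 (oner_neq0 _); rewrite rmorph1 mul1r in u1E.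
have r10 : r + 1 != 0 by rewrite -(rmorph1 s) rc0 ?oner_neq0.
have u1F : u1 / u \notin codom s.
  apply: contra rF => /codomP[a aE]; apply/codomP.
  have u10 : u1 != 0 by apply: contraNneq u0 => u10; rewrite -u1E u10 mul0r.
  exists (a^-1 - 1); rewrite rmorphB fmorphV -aE rmorph1 -u1E.
  by field; rewrite r10 u10 oner_neq0.
(* For [c] other than 0 and 1, writing [uC] as a u + b u1 and clearing the denominators r + 1 and r
   + c gives a quadratic relation for [r]. It forces a = 0, then b = c, then c = 1. *)
have Fle2 : (#|F| <= 2)%N.
  rewrite leqNgt; apply/negP => /card_gt2_exists[c c0 c1].
  have [uC ucW [ucE _]] := uc c c0.
  have [a [b abE]] := slope_span uW u1W ucW u0 u1F.
  have E : s (a * c + b * c - c) + s (a + a * c + b - c) * r + s a * r ^+ 2 = 0.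
    rewrite !(rmorphD, rmorphB, rmorphM); apply: (mulIf u0); rewrite mul0r.
    transitivity ((s a * u) * (r + 1) * (r + s c) + s b * u * (r + s c) - (s c * u) * (r + 1)).
      by ring.
    rewrite -ucE abE -{2}u1E; ring.
  have a0 := rmorph_indep3 cardL rF E.
  move: E; rewrite a0 rmorph0 !mul0r !add0r addr0 => /(rmorph_indep2 rF)[].
  move=> E1 /eqP; rewrite subr_eq0 => /eqP bc; move: E1; rewrite bc => /eqP.
  by rewrite -{3}[c]mulr1 -mulrBr mulf_eq0 (negPf c0) subr_eq0 (negPf c1).
split=> //.
have F01 (a : F) : a = 0 \/ a = 1.
  have [->|a0] := eqVneq a 0; first by left.
  have [->|a1] := eqVneq a 1; first by right.
  suff: (2 < #|F|)%N by rewrite ltnNge Fle2.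
  have <- : #|[set 0; 1; a]| = 3%N.
    by rewrite setUC cardsU1 !inE (negPf a0) (negPf a1) cards2 eq_sym oner_neq0.
  exact: max_card.
have u1t0 : u1 * t2 != 0.
  by rewrite mulf_neq0 //; apply: contraNneq u1F => ->; rewrite mul0r -(rmorph0 s) codom_f.
(* The added point is chosen so that its sum with [G x2 t2] has slope w2 + u1, the one slope absent
   from [l]. *)
exists (l + <[G (u1 * t2)%R 0%R]>)%VS.
have uP : G (u1 * t2) 0 \in (l + <[G (u1 * t2)%R 0%R]>)%VS.
  exact/(subvP (addvSr _ _))/memv_line.
split; last exact: addvSl.
- by rewrite dimv_add_line ?l_dim //; apply: contra u1t0 => /l0->.
- by rewrite subv_add l_sub -memvE G_mem.
have lP := subvP (addvSl l <[G (u1 * t2)%R 0%R]>).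
split; first by exists (u1 * t2).
move=> w wW.
have [a [b abE]] := slope_span uW u1W (slopeB wW w1W) u0 u1F.
have wE : w = w1 + s a * u + s b * u1 by rewrite -addrA -abE addrC subrK.
(* The four cases are the slopes w1, w1 + u1, w1 + u = w2 and w2 + u1, in this order. *)
rewrite wE; case: (F01 a) (F01 b) => -> [] ->; rewrite ?rmorph0 ?rmorph1 ?mul0r ?mul1r ?addr0.
- by exists t1 => //; rewrite -x1E lP.
- exists (t1 + t2); first by rewrite t1E -[X in _ + X]mul1r -mulrDl mulf_neq0.
  have := u1x; rewrite rmorph1 !mul1r => <-.
  by rewrite GD memvD // lP.
- by exists t2 => //; rewrite /u addrC subrK -x2E lP.
- exists t2 => //; rewrite {1}/u [w1 + _]addrC subrK mulrDl -x2E -[t2 in G _ t2]addr0 GD.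
  by rewrite memvD // lP.
Qed.

(** A line missing the centre forces #|F| <= 2, where the uniqueness clause is void. Otherwise the
    normal form of [l] yields [t]; for #|F| > 2 every cover plane through [l] contains
    [standard_cover t] and equals it by dimension. *)
Lemma unique_cover_through_line :
  exists P, [/\ [/\ \dim P = 3, (P <= Sg)%VS & covers P], (l <= P)%VS
    & (2 < #|F|)%N -> forall P', (P' <= Sg)%VS -> \dim P' = 3 -> covers P' ->
        (l <= P')%VS -> P' = P].
Proof.
have [/existsP[y /andP[y0 yl]]|/existsPn l0] :=
    boolP [exists y, (y != 0) && (G y 0 \in l)]; last first.
  have [|F2 [P [dP PSg covP lP]]] := line_off_infinity.
    by move=> y yl; apply/eqP; have := l0 y; rewrite yl andbT negbK.
  by exists P; split=> //; rewrite ltnNge F2.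
have [t [u [w [[t0 u0 uW wW] lE]]]] := line_through_infinity y0 yl.
exists (standard_cover t); split; last first.
- move=> F2 P' P'Sg dP' covP' lP'; apply/esym/eqP.
  rewrite eqEdim dim_standard_cover // dP' leqnn andbT.
  move: lP'; rewrite lE subv_add -!memvE => /andP[].
  exact: covers_sub_standard.
- rewrite lE subv_add -!memvE -(mul0r t) -(rmorph0 s) mem_standard_cover //=.
  by rewrite -[X in G _ X]mul1r -(rmorph1 s) mem_standard_cover.
split; [exact: dim_standard_cover| |exact: covers_standard_cover].
by rewrite !subv_add -!memvE !G_mem.
Qed.

End CoverPlanes.

(** * Coordinates for a Bruck-Bose representation *)

Section AffinePoints.

Variables (K : fieldType) (vT : vectType K).
Implicit Types (U H : {vspace vT}) (v : vT).

Lemma dimv1_line U : \dim U = 1%N -> exists2 v, v != 0 & U = <[v]>%VS.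
Proof.
move=> dU; have v0 : vpick U != 0 by rewrite vpick0 -dimv_eq0 dU.
exists (vpick U) => //; apply/esym/eqP.
by rewrite eqEdim dim_vline v0 dU -memvE memv_pick.
Qed.

Lemma eq_vline v w : v != 0 -> v \in <[w]>%VS -> <[v]>%VS = <[w]>%VS.
Proof.
move=> v0 vw; apply/eqP; rewrite eqEdim -memvE vw !dim_vline v0.
by case: (w != 0).
Qed.

(** With [v0] as origin, the points off the hyperplane [H] become vectors of [H]: scale a
    representative to have [v0]-component 1. Uniqueness of [x] is [affine_point_inj]. *)
Lemma affine_point H v0 v :
    v0 \notin H -> (\dim H).+1 = \dim {:vT} -> v \notin H ->
  exists2 x, x \in H & <[v]>%VS = <[v0 + x]>%VS.
Proof.
move=> v0H dH vH; have : v \in (H + <[v0]>)%VS.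
  by rewrite -(addv_line_eq (subvf H) _ v0H) ?memvf.
case/memv_addP => h hH [_ /vlineP[a ->] vE].
have a0 : a != 0 by apply: contraNneq vH => a0; rewrite vE a0 scale0r addr0.
exists (a^-1 *: h); first by rewrite memvZ.
apply: eq_vline; first by apply: contraNneq vH => ->; rewrite mem0v.
by apply/vlineP; exists a; rewrite scalerDr scalerA divff // scale1r addrC.
Qed.

Lemma affine_point_inj H v0 x y : v0 \notin H -> x \in H -> y \in H ->
  <[v0 + x]>%VS = <[v0 + y]>%VS -> x = y.
Proof.
move=> v0H xH yH E; have /vlineP[k] : v0 + x \in <[v0 + y]>%VS.
  by rewrite -E memv_line.
rewrite scalerDr => kE; have : (1 - k) *: v0 \in H.
  have -> : (1 - k) *: v0 = k *: y - x.
    by rewrite scalerBl scale1r; apply/eqP; rewrite subr_eq addrAC eq_sym subr_eq kE addrC.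
  by rewrite memvB // memvZ.
have [k1 _|k1] := eqVneq (1 - k) 0; last first.
  move=> kH; case/negP: v0H.
  by rewrite -(scalerK k1 v0) memvZ.
have k_1 : k = 1 by apply/esym/eqP; rewrite -subr_eq0 k1.
by move: kE; rewrite k_1 !scale1r => /addrI.
Qed.

Lemma affine_notin H v0 x : v0 \notin H -> x \in H -> v0 + x \notin H.
Proof. by move=> v0H xH; rewrite rpredDr. Qed.

End AffinePoints.

Lemma rmorphism_exists (R1 R2 : finFieldType) (f : R1 -> R2) :
    (forall x y, f (x - y) = f x - f y) -> f 1 = 1 ->
    (forall x y, f (x * y) = f x * f y) ->
  exists s : {rmorphism R1 -> R2}, s =1 f.
Proof.
move=> fB f1 fM.
pose fa := GRing.isZmodMorphism.Build R1 R2 f fB.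
pose fm := GRing.isMonoidMorphism.Build R1 R2 f (f1, fM).
pose s : {rmorphism R1 -> R2} := HB.pack f fa fm.
by exists s.
Qed.

Lemma line_in_points (K : finFieldType) n (v : 'rV[K]_n.+1) :
  v != 0 -> <[v]>%VS \in @points n K.
Proof. by move=> v0; rewrite inE dim_vline v0. Qed.

Section BruckBoseCoordinates.

Variables (F L : finFieldType) (Sigma : PG 6 F) (S : {set PG 6 F}).
Variables (linf : PG 2 L) (phi psi : PG 2 L -> PG 6 F).
Hypothesis hSigma : Sigma \in hyperplanes.
Hypothesis spreadS : is_2spread Sigma S.
Hypothesis hlinf : linf \in lines.
Hypothesis hBB : bruck_bose Sigma S linf phi psi.

Lemma Sigma_dim : \dim Sigma = 6%N.
Proof. by move: hSigma; rewrite inE => /eqP. Qed.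

Lemma linf_dim : \dim linf = 2%N.
Proof. by move: hlinf; rewrite inE => /eqP. Qed.

Lemma phi_inj : {in points &, injective phi}.
Proof. by case: hBB => [[]]. Qed.

Lemma phi_incident P m :
  P \in points -> m \in lines -> (phi P <= psi m)%VS = (P <= m)%VS.
Proof. by case: hBB => _ _ H _; apply: H. Qed.

Lemma spread_plane U : U \in S -> \dim U = 3%N /\ (U <= Sigma)%VS.
Proof.
case: spreadS => /subsetP H _ /H; rewrite !inE => /andP[/eqP ? ?]; by split.
Qed.

Lemma spread_plane_eq U U' v :
  U \in S -> U' \in S -> v != 0 -> v \in U -> v \in U' -> U = U'.
Proof.
move=> US US' v0 vU vU'; case: spreadS => _ H.
have vS : (<[v]> <= Sigma)%VS by rewrite -memvE (subvP (spread_plane US).2).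
have /eqP/cards1P[X XE] := H _ (line_in_points v0) vS.
have inX W : W \in S -> v \in W -> W = X.
  by move=> WS vW; apply/set1P; rewrite -XE inE WS -memvE.
by rewrite (inX U) // (inX U').
Qed.

Lemma psi_linf : psi linf = Sigma. Proof. by case: hBB. Qed.

Lemma phi_bb_points P : P \in points -> phi P \in bb_points Sigma S.
Proof. by move=> Pp; case: hBB => [[_ <-]] _ _ _; apply: imset_f. Qed.

Lemma phi_at_infinity X : X \in points -> (X <= linf)%VS -> phi X \in S.
Proof.
move=> Xp Xl; have := phi_bb_points Xp.
by rewrite inE => /orP[|//]; rewrite inE -psi_linf phi_incident // Xl andbF.
Qed.

Lemma phi_affine P : P \in points -> ~~ (P <= linf)%VS ->
  phi P \in points /\ ~~ (phi P <= Sigma)%VS.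
Proof.
move=> Pp Pl; have := phi_bb_points Pp.
have PS : ~~ (phi P <= Sigma)%VS by rewrite -psi_linf phi_incident.
rewrite inE => /orP[|/spread_plane[_]]; last by rewrite (negPf PS).
by rewrite inE => /andP[].
Qed.

(** Injectivity of [psi] excludes [psi m = Sigma], so [psi m] is a solid not inside [Sigma]. The
    intersection thus has linear dimension at most 3, and it contains [phi X], of dimension 3. *)
Lemma psi_at_infinity m X : m \in lines -> m != linf -> X \in points ->
  (X <= m)%VS -> (X <= linf)%VS -> (psi m :&: Sigma)%VS = phi X.
Proof.
move=> ml mlinf Xp Xm Xl; have [dX XS] := spread_plane (phi_at_infinity Xp Xl).
have : psi m \in bb_lines Sigma S.
  by case: hBB => _ [_ <-] _ _; apply: imset_f.
case/setU1P => [mS|].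
  have [_ [psiI _] _ _] := hBB.
  by case/eqP: mlinf; apply: psiI; rewrite ?psi_linf.
rewrite !inE => /and3P[/eqP dm mS _]; apply/esym/eqP.
have XmS : (phi X <= psi m :&: Sigma)%VS by rewrite subv_cap phi_incident // Xm.
have : (\dim (psi m :&: Sigma) < \dim (psi m))%N.
  rewrite ltn_neqAle dimvS ?capvSl // andbT.
  by apply: contra mS => /eqP E; apply/capv_idPl/eqP; rewrite eqEdim capvSl E leqnn.
by rewrite eqEdim XmS dX dm.
Qed.

Variables (v0 : 'rV[L]_3).
Hypothesis v0_linf : v0 \notin linf.

(** With [O] spanning the image of <v0>, [g x] is defined by phi <v0 + x> = <O + g x>. For distinct
    [x], [y] the line joining v0 + x and v0 + y has <x - y> as its point at infinity, whence the
    last clause. *)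
Lemma exists_translation :
  exists g : 'rV[L]_3 -> 'rV[F]_7,
    [/\ g 0 = 0, {in linf, forall x, g x \in Sigma},
        {in linf &, injective g}, {in Sigma, forall y, exists2 x, x \in linf & y = g x}
      & {in linf &, forall x y, x != y -> g x - g y \in phi <[x - y]>%VS}].
Proof.
have aff_pt x : x \in linf -> <[v0 + x]>%VS \in points /\ ~~ (<[v0 + x]> <= linf)%VS.
  move=> xl; have vxl := affine_notin v0_linf xl; rewrite -memvE vxl; split=> //.
  by apply: line_in_points; apply: contraNneq vxl => ->; rewrite mem0v.
have aff_phi x : x \in linf -> exists2 v, v \notin Sigma & phi <[v0 + x]>%VS = <[v]>%VS.
  move=> /aff_pt[/phi_affine H /H[]]; rewrite inE => /eqP/dimv1_line[v _ ->].
  by rewrite -memvE => vS; exists v.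
have [O OS phiO] := aff_phi 0 (mem0v _).
(* For [x] in [linf] the search succeeds by [affine_point], so the default 0 is never taken
   there. *)
pose g x := odflt 0 [pick y in Sigma | phi <[v0 + x]>%VS == <[O + y]>%VS].
have gP x : x \in linf -> g x \in Sigma /\ phi <[v0 + x]>%VS = <[O + g x]>%VS.
  move=> xl; rewrite /g; case: pickP => [y /andP[yS /eqP->] //|H].
  have [v vS phix] := aff_phi x xl.
  have [|y yS vE] := affine_point OS _ vS; first by rewrite Sigma_dim dimvf.
  by have := H y; rewrite /= yS phix vE eqxx.
have gS x : x \in linf -> g x \in Sigma by move=> /gP[].
exists g; split => //.
- apply: (affine_point_inj OS (gS _ (mem0v _)) (mem0v _)).
  by rewrite -(gP _ (mem0v _)).2 phiO addr0.
- move=> x y xl yl gxy; apply: (affine_point_inj v0_linf xl yl).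
  have [xp _] := aff_pt x xl; have [yp _] := aff_pt y yl.
  by apply: phi_inj => //; rewrite (gP x xl).2 (gP y yl).2 gxy.
- move=> y yS; have OyS := affine_notin OS yS.
  have : <[O + y]>%VS \in bb_points Sigma S.
    rewrite inE; apply/orP; left; rewrite !inE -memvE OyS andbT dim_vline.
    by have -> : O + y != 0 by apply: contraNneq OyS => ->; rewrite mem0v.
  have [[_ <-] _ _ _] := hBB; case/imsetP => P Pp PE.
  have Pl : ~~ (P <= linf)%VS by rewrite -phi_incident // -PE psi_linf -memvE.
  move: (Pp); rewrite inE => /eqP/dimv1_line[v _ vE].
  have vl : v \notin linf by rewrite memvE -vE.
  have [|x xl xE] := affine_point v0_linf _ vl; first by rewrite linf_dim dimvf.
  exists x => //; apply: (affine_point_inj OS yS (gS x xl)).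
  by rewrite -(gP x xl).2 -xE -vE.
move=> x y xl yl xy; have xy0 : x - y != 0 by rewrite subr_eq0.
pose m : PG 2 L := (<[x - y]> + <[v0 + x]>)%VS.
have xyl : x - y \in linf by rewrite memvB.
have vxl := affine_notin v0_linf xl.
have ml : m \in lines.
  rewrite inE dimv_add_line ?dim_vline ?xy0 //.
  by apply: contra vxl => /vlineP[k ->]; rewrite memvZ.
have vxm : v0 + x \in m by apply/(subvP (addvSr _ _))/memv_line.
have xym : x - y \in m by apply/(subvP (addvSl _ _))/memv_line.
have vym : v0 + y \in m by have := memvB vxm xym; rewrite opprB addrA addrAC addrK.
have mlinf : m != linf by apply: contraNneq vxl => <-.
rewrite -(psi_at_infinity ml mlinf (line_in_points xy0)) -?memvE // memv_cap.
rewrite (memvB (gS x xl) (gS y yl)) andbT.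
have Og z : z \in linf -> v0 + z \in m -> O + g z \in psi m.
  move=> zl zm; have [_ E] := gP z zl; have [zp _] := aff_pt z zl.
  by rewrite memvE -E phi_incident // -memvE.
by have := memvB (Og x xl vxm) (Og y yl vym); rewrite opprD addrACA subrr add0r.
Qed.

(* g represents each affine point <v0 + x> relative to the image of <v0>. It is
   additive by closing parallelograms. As the scalars of F preserve the planes
   of S, they act on linf as scalars of L. *)
Lemma bruck_bose_semilinear :
  exists (s : {rmorphism F -> L}) (g : 'rV[L]_3 -> 'rV[F]_7),
    [/\ {in linf &, {morph g : x y / x + y}},
        forall a, {in linf, forall x, g (s a *: x) = a *: g x},
        {in linf &, injective g},
        {in linf, forall x, g x \in Sigma} /\
          {in Sigma, forall y, exists2 x, x \in linf & y = g x}
      & {in linf, forall x v, x != 0 ->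
          v \in phi <[x]>%VS <-> exists c, v = g (c *: x)}].
Proof.
have [g [g0 gS gI gonto gsub]] := exists_translation.
(* For independent [x], [y] the defect g (x + y) - g x - g y lies in the spread planes of both <x>
   and <y>, which are distinct, so it is 0. *)
have gD1 x y : x \in linf -> y \in linf -> x != 0 -> y \notin <[x]>%VS -> g (x + y) = g x + g y.
  move=> xl yl x0 yx; have y0 : y != 0 by apply: contraNneq yx => ->; rewrite mem0v.
  have xyl : x + y \in linf by rewrite memvD.
  have gphi z : z \in linf -> z != 0 -> g z \in phi <[z]>%VS.
    by move=> zl z0; have := gsub z 0 zl (mem0v _) z0; rewrite g0 !subr0.
  have zx : g (x + y) - g x - g y \in phi <[y]>%VS.
    have := gsub (x + y) x xyl xl; rewrite [x + y]addrC addrK => H.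
    by rewrite memvB ?gphi // H // -subr_eq0 addrK.
  have zy : g (x + y) - g x - g y \in phi <[x]>%VS.
    rewrite addrAC memvB ?gphi //; have := gsub (x + y) y xyl yl; rewrite addrK => H.
    by rewrite H // -subr_eq0 addrK.
  apply/eqP; rewrite -subr_eq0 opprD addrA; apply/negPn/negP => n0.
  have xp := line_in_points x0; have yp := line_in_points y0.
  have inl z : z \in linf -> (<[z]> <= linf)%VS by rewrite -memvE.
  have E := spread_plane_eq (phi_at_infinity xp (inl _ xl))
    (phi_at_infinity yp (inl _ yl)) n0 zy zx.
  by case/negP: yx; rewrite (phi_inj xp yp E) memv_line.
have gD : {in linf &, {morph g : x y / x + y}}.
  move=> x y xl yl; have [->|x0] := eqVneq x 0; first by rewrite g0 !add0r.
  have [yx|] := boolP (y \in <[x]>%VS); last exact: gD1.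
  (* An auxiliary [z] outside <x> reduces the dependent case: g (x + y + z) is expanded in two ways,
     adding independent vectors each time. *)
  have [|z zl zx] := @memv_notin_lt _ _ <[x]>%VS linf; first by rewrite linf_dim dim_vline x0.
  have [->|y0] := eqVneq y 0; first by rewrite g0 !addr0.
  have zN w : w != 0 -> w \in <[x]>%VS -> z \notin <[w]>%VS.
    by move=> w0 wx; rewrite (eq_vline w0 wx).
  have yzx : y + z \notin <[x]>%VS by rewrite rpredDl.
  have : g (x + y + z) = g x + (g y + g z).
    have yzl : y + z \in linf by rewrite memvD.
    have yz := zN y y0 yx.
    by rewrite -addrA (gD1 x _ xl yzl x0 yzx) (gD1 y).
  have [xy0|xy0] := eqVneq (x + y) 0.
    by rewrite xy0 add0r g0 => /eqP; rewrite addrA -subr_eq subrr => /eqP.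
  have xyx : x + y \in <[x]>%VS by rewrite memvD ?memv_line.
  by rewrite (gD1 _ z (memvD xl yl) zl xy0 (zN _ xy0 xyx)) addrA => /addIr.
have phi_g x y : x \in linf -> y \in linf -> x != 0 -> g y \in phi <[x]>%VS -> y \in <[x]>%VS.
  move=> xl yl x0 yx; have [->|y0] := eqVneq y 0; first exact: mem0v.
  have gy0 : g y != 0.
    by apply: contra_neq y0 => gy0; apply: gI; rewrite ?mem0v // gy0 g0.
  have gy : g y \in phi <[y]>%VS.
    by have := gsub y 0 yl (mem0v _) y0; rewrite g0 !subr0.
  have xp := line_in_points x0; have yp := line_in_points y0.
  have inl z : z \in linf -> (<[z]> <= linf)%VS by rewrite -memvE.
  have E := spread_plane_eq (phi_at_infinity xp (inl _ xl))
    (phi_at_infinity yp (inl _ yl)) gy0 yx gy.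
  by rewrite (phi_inj xp yp E) memv_line.
have g_phi x c : x \in linf -> x != 0 -> g (c *: x) \in phi <[x]>%VS.
  move=> xl x0; have [->|c0] := eqVneq c 0; first by rewrite scale0r g0 mem0v.
  have cx0 : c *: x != 0 by rewrite scaler_eq0 negb_or c0.
  have := gsub (c *: x) 0 (memvZ _ xl) (mem0v _) cx0; rewrite g0 !subr0.
  by rewrite (@eq_vline _ _ _ x cx0) // memvZ // memv_line.
(* The spread plane of <x> is an F-subspace, so it contains a g x, whose preimage is an L-multiple
   of [x]. *)
have dil (a : F) x : x \in linf -> exists c, a *: g x = g (c *: x).
  move=> xl; have [->|x0] := eqVneq x 0; first by exists 0; rewrite scaler0 g0 scaler0.
  have [y yl yE] := gonto _ (memvZ a (gS _ xl)).
  have /vlineP[c yc] : y \in <[x]>%VS.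
    by apply: phi_g => //; rewrite -yE memvZ // -[x in g x]scale1r g_phi.
  by exists c; rewrite yE yc.
(* Comparing the factors at [x], [y] and x + y shows that they agree for independent vectors. *)
have dil_eq (a : F) c x y : x \in linf -> y \in linf -> x != 0 -> y \notin <[x]>%VS ->
    a *: g x = g (c *: x) -> a *: g y = g (c *: y).
  move=> xl yl x0 yx xE; have [d yE] := dil a y yl.
  have [e xyE] := dil a (x + y) (memvD xl yl).
  have E : e *: (x + y) = c *: x + d *: y.
    apply: gI; rewrite ?memvZ ?memvD ?memvZ //.
    by rewrite -xyE !gD ?memvZ // scalerDr xE yE.
  have E1 : (e - d) *: y = (c - e) *: x.
    apply/eqP; rewrite !scalerBl subr_eq addrAC eq_sym subr_eq -E scalerDr addrC.
    by [].
  have ed : e = d.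
    apply/eqP; rewrite -subr_eq0; apply: contraNT yx => ed0.
    by rewrite -(scalerK ed0 y) E1 !memvZ // memv_line.
  move: E1; rewrite ed subrr scale0r => /esym/eqP.
  by rewrite scaler_eq0 (negPf x0) orbF subr_eq0 => /eqP ->; rewrite yE.
have [|e1 e1l] := @memv_notin_lt _ _ 0%VS linf; first by rewrite dimv0 linf_dim.
rewrite memv0 => e10; have [|e0 e0l e01] := @memv_notin_lt _ _ <[e1]>%VS linf.
  by rewrite linf_dim dim_vline e10.
have e00 : e0 != 0 by apply: contraNneq e01 => ->; rewrite mem0v.
have e1_0 : e1 \notin <[e0]>%VS.
  by apply: contra e01 => /(eq_vline e10)->; rewrite memv_line.
pose sg a := odflt 0 [pick c | a *: g e1 == g (c *: e1)].
have sg1 a : a *: g e1 = g (sg a *: e1).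
  rewrite /sg; case: pickP => [c /eqP //|H].
  by have [c cE] := dil a e1 e1l; have := H c; rewrite cE eqxx.
(* Multiples of [e1] are compared with [e1] through the independent vector [e0]. *)
have sgP a x : x \in linf -> a *: g x = g (sg a *: x).
  move=> xl; have [xe|] := boolP (x \in <[e1]>%VS); last by move=> xe; apply: (dil_eq _ _ e1).
  have [->|x0] := eqVneq x 0; first by rewrite scaler0 g0 scaler0.
  apply: (dil_eq _ _ e0) => //; last exact: (dil_eq _ _ e1).
  by apply: contra e1_0 => /(eq_vline x0) <-; rewrite (eq_vline x0 xe) memv_line.
have sgI c d : g (c *: e1) = g (d *: e1) -> c = d.
  move=> /gI E; have := E (memvZ _ e1l) (memvZ _ e1l) => /eqP.
  by rewrite -subr_eq0 -scalerBl scaler_eq0 (negPf e10) orbF subr_eq0 => /eqP.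
have sgD a b : sg (a + b) = sg a + sg b.
  by apply: sgI; rewrite -sg1 !scalerDl gD ?memvZ // -!sg1.
have [||| s sE] := @rmorphism_exists F L sg.
- by move=> a b; apply/eqP; rewrite eq_sym subr_eq -sgD subrK.
- by apply: sgI; rewrite -sg1 !scale1r.
- by move=> a b; apply: sgI; rewrite -sg1 -!scalerA -sgP ?memvZ // -sg1.
exists s, g; split=> //.
  by move=> a x xl; rewrite sgP // sE.
move=> x xl v x0; split=> [vx|[c ->]]; last exact: g_phi.
have inl : (<[x]> <= linf)%VS by rewrite -memvE.
have [_ XS] := spread_plane (phi_at_infinity (line_in_points x0) inl).
have [y yl yE] := gonto v (subvP XS _ vx).
have /vlineP[c cE] : y \in <[x]>%VS by apply: phi_g => //; rewrite -yE.
by exists c; rewrite yE cE.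
Qed.

End BruckBoseCoordinates.

(** * Coordinates for a subplane and its tangent splash *)

Section OrderSubplane.

Variables (L : finFieldType) (q : nat) (B : {set PG 2 L}).
Hypothesis q_gt1 : (1 < q)%N.
Hypothesis hB : order_subplane q B.
Implicit Types (a b x : 'rV[L]_3) (m : PG 2 L).

Lemma subplane_point P : P \in B -> exists2 a, a != 0 & P = <[a]>%VS.
Proof.
case: hB => /subsetP H _ _ _ /H; rewrite inE => /eqP; exact: dimv1_line.
Qed.

Lemma subplane_neq0 a : <[a]>%VS \in B -> a != 0.
Proof.
by case: hB => /subsetP H _ _ _ /H; rewrite inE dim_vline; case: (a != 0).
Qed.

Lemma subline_dim m : m \in sublines B -> \dim m = 2.
Proof. by rewrite !inE => /andP[/eqP]. Qed.

Lemma join_subline a b : <[a]>%VS \in B -> <[b]>%VS \in B -> b \notin <[a]>%VS ->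
  (<[a]> + <[b]>)%VS \in sublines B.
Proof.
move=> aB bB ba; have a0 := subplane_neq0 aB.
rewrite inE; apply/andP; split; first by rewrite inE dimv_add_line // dim_vline a0.
apply/card_gt1P; exists <[a]>%VS, <[b]>%VS; rewrite !inE aB bB addvSl addvSr.
by split=> //; apply: contraNneq ba => ->; rewrite memv_line.
Qed.

(** Distinct lines of PG(2, L) share one point only, and the subplane axiom supplies a common point
    in [B]; so that point is <x>. *)
Lemma meet_subline m m' x : m \in sublines B -> m' \in sublines B -> m != m' ->
  x != 0 -> x \in m -> x \in m' -> <[x]>%VS \in B.
Proof.
move=> mB m'B mm' x0 xm xm'; have [_ H _ _] := hB.
have [P PB /andP[Pm Pm']] := H _ _ mB m'B mm'.
have [p p0 PE] := subplane_point PB; rewrite {}PE in PB Pm Pm'.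
have [xp|xp] := boolP (x \in <[p]>%VS); first by rewrite (eq_vline x0 xp).
have dp : (\dim <[p]>).+1 = 2%N by rewrite dim_vline p0.
case/eqP: mm'; rewrite (addv_line_eq Pm xm xp) ?(subline_dim mB) //.
by rewrite (addv_line_eq Pm' xm' xp) ?(subline_dim m'B).
Qed.

Lemma lines_meet m m' : \dim m = 2 -> \dim m' = 2 ->
  exists2 x, x != 0 & (x \in m) && (x \in m').
Proof.
move=> dm dm'; have [|x xm x0] := @memv_notin_lt _ _ 0%VS (m :&: m')%VS.
  rewrite dimv0; have := dimv_sum_cap m m'; rewrite dm dm'.
  have : (\dim (m + m') <= 3)%N by rewrite (leq_trans (dimvS (subvf _))) // dimvf.
  by case: (\dim (m :&: m')) => //; rewrite addn0 => + E; rewrite E.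
by exists x; rewrite -?memv0 // -memv_cap.
Qed.

Lemma noncollinear_notin a b c : a != 0 -> noncollinear <[a]>%VS <[b]>%VS <[c]>%VS ->
  b \notin <[a]>%VS /\ c \notin (<[a]> + <[b]>)%VS.
Proof.
move=> a0 /existsPn H.
have noline v : v \notin <[a]>%VS -> b \in (<[a]> + <[v]>)%VS ->
    c \notin (<[a]> + <[v]>)%VS.
  move=> va bv; have := H (<[a]> + <[v]>)%VS.
  by rewrite inE dimv_add_line // dim_vline a0 addvSl /= -!memvE bv.
have ba : b \notin <[a]>%VS.
  apply/negP => ba; have ba' v : b \in (<[a]> + <[v]>)%VS by apply: (subvP (addvSl _ _)).
  have [ca|ca] := boolP (c \in <[a]>%VS); last first.
    by case/negP: (noline c ca (ba' c)); apply/(subvP (addvSr _ _))/memv_line.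
  have [|v _ va] := @memv_notin_lt _ _ <[a]>%VS fullv; first by rewrite dim_vline a0 dimvf.
  by case/negP: (noline v va (ba' v)); apply/(subvP (addvSl _ _)).
by split=> //; apply: noline => //; apply/(subvP (addvSr _ _))/memv_line.
Qed.

(** No point lies on all three sides of a triangle [p], [u], [r] of the subplane: the only point on
    both pu and pr is <p>, which is off ur. *)
Lemma subline_off t : <[t]>%VS \in B -> exists2 m, m \in sublines B & t \notin m.
Proof.
move=> tB; have [_ _ [P [Q [R [_ [[PB QB RB _] PQR _ _ _]]]]] _] := hB.
have [p p0 PE] := subplane_point PB; have [u _ QE] := subplane_point QB.
have [r _ RE] := subplane_point RB; subst P Q R.
have [up rpu] := noncollinear_notin p0 PQR.
have rp : r \notin <[p]>%VS by apply: contra rpu; apply/(subvP (addvSl _ _)).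
have ru : r \notin <[u]>%VS by apply: contra rpu; apply/(subvP (addvSr _ _)).
have [tpu|] := boolP (t \in <[p]> + <[u]>)%VS; last first.
  by exists (<[p]> + <[u]>)%VS => //; apply: join_subline.
have [|] := boolP (t \in <[p]> + <[r]>)%VS; last first.
  by exists (<[p]> + <[r]>)%VS => //; apply: join_subline.
case/memv_line2 => a [b tE].
have b0 : b = 0.
  apply: contraNeq rpu => b0; rewrite -(scalerK b0 r) memvZ //.
  have -> : b *: r = t - a *: p by rewrite tE addrC addKr.
  by rewrite memvB // memvZ // (subvP (addvSl _ _)) // memv_line.
rewrite b0 scale0r addr0 in tE.
exists (<[u]> + <[r]>)%VS; first exact: join_subline.
apply/negP; rewrite tE => /memv_line2[c [d E]].
have a0 : a != 0.
  by apply: contraNneq (subplane_neq0 tB) => a0; rewrite tE a0 scale0r.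
have d0 : d = 0.
  apply: contraNeq rpu => d0; rewrite -(scalerK d0 r) memvZ //.
  have -> : d *: r = a *: p - c *: u by rewrite E addrC addKr.
  by rewrite memvB // memvZ // memvE ?addvSl ?addvSr.
rewrite d0 scale0r addr0 in E.
have c0 : c != 0.
  by apply: contraNneq p0 => c0; rewrite -(scalerK a0 p) E c0 scale0r scaler0.
by case/negP: up; rewrite -(scalerK c0 u) -E !memvZ // memv_line.
Qed.

Lemma card_subline m : m \in sublines B -> #|points_on B m| = q.+1.
Proof. by case: hB => _ _ _; apply. Qed.

(** As q > 1, a subline missing [T] has three points Q, R, U, and the line TU has a third point P.
    Then T, Q, R, P form a quadrangle, and scaling makes P the unit point. *)
Lemma frame_at T : T \in B -> exists e1 e2 e3,
  [/\ T = <[e1]>%VS, [/\ <[e1]>%VS \in B, <[e2]>%VS \in B, <[e3]>%VS \in B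
      & <[e1 + e2 + e3]>%VS \in B]
    & forall x y z : L, x *: e1 + y *: e2 + z *: e3 = 0 -> [/\ x = 0, y = 0 & z = 0]].
Proof.
move=> TB; have [t t0 TE] := subplane_point TB; rewrite {}TE in TB *.
have [m mB tm] := subline_off TB.
have /card_gt2P[Q [R [U [[]]]]] : (2 < #|points_on B m|)%N by rewrite card_subline.
rewrite !inE => /andP[QB Qm] /andP[RB Rm] /andP[UB Um] [QR RU UQ].
have [e2 e20 QE] := subplane_point QB; have [e3 e30 RE] := subplane_point RB.
have [u u0 UE] := subplane_point UB.
subst Q R U; rewrite -!memvE in Qm Rm Um.
have e32 : e3 \notin <[e2]>%VS by apply: contra QR => /(eq_vline e30)->.
have mE : m = (<[e2]> + <[e3]>)%VS.
  by apply: addv_line_eq; rewrite ?(subline_dim mB) ?dim_vline ?e20 -?memvE.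
have /memv_line2[be [ga uE]] : u \in (<[e2]> + <[e3]>)%VS by rewrite -mE.
have be0 : be != 0.
  apply: contraNneq RU => be0; rewrite eq_sym; apply/eqP/eq_vline => //.
  by rewrite uE be0 scale0r add0r memvZ // memv_line.
have ga0 : ga != 0.
  apply: contraNneq UQ => ga0; apply/eqP/eq_vline => //.
  by rewrite uE ga0 scale0r addr0 memvZ // memv_line.
have ut : u \notin <[t]>%VS.
  apply: contra tm => /(eq_vline u0) E.
  by rewrite memvE -E -memvE.
have tuB := join_subline TB UB ut.
have /set0Pn[P] : points_on B (<[t]> + <[u]>) :\: [set <[t]>%VS; <[u]>%VS] != set0.
  apply/negP => /eqP/eqP; rewrite setD_eq0 => /subset_leq_card.
  rewrite (card_subline tuB) cards2 leqNgt; apply/negP/negPn.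
  by rewrite ltnS (leq_trans _ q_gt1) // ltnS; case: (_ != _).
rewrite !inE negb_or => /andP[/andP[Pt Pu] /andP[PB Ptu]].
have [v v0 PE] := subplane_point PB; rewrite {}PE -?memvE in PB Pt Pu Ptu.
have /memv_line2[al [de vE]] := Ptu.
have al0 : al != 0.
  apply: contraNneq Pu => al0; apply/eqP/eq_vline => //.
  by rewrite vE al0 scale0r add0r memvZ // memv_line.
have de0 : de != 0.
  apply: contraNneq Pt => de0; apply/eqP/eq_vline => //.
  by rewrite vE de0 scale0r addr0 memvZ // memv_line.
have lineZ (k : L) (w : 'rV[L]_3) : k != 0 -> w != 0 -> <[k *: w]>%VS = <[w]>%VS.
  by move=> k0 w0; apply: eq_vline; rewrite ?scaler_eq0 ?negb_or ?k0 ?memvZ ?memv_line.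
have db0 := mulf_neq0 de0 be0; have dg0 := mulf_neq0 de0 ga0.
(* Since u = be e2 + ga e3 and v = al t + de u, these multiples sum to [v]. *)
exists (al *: t), ((de * be) *: e2), ((de * ga) *: e3); rewrite !lineZ //; split=> //.
  split=> //; suff -> : al *: t + (de * be) *: e2 + (de * ga) *: e3 = v by [].
  by rewrite vE uE scalerDr !scalerA addrA.
move=> x y z; rewrite !scalerA -addrA => E.
have x0 : x = 0.
  apply: contraNeq tm => x0; have xa0 := mulf_neq0 x0 al0.
  rewrite -(scalerK xa0 t) memvZ //; move/eqP: E; rewrite addr_eq0 => /eqP->.
  by rewrite memvN memvD // memvZ.
move: E; rewrite x0 mul0r scale0r add0r => E.
have z0 : z = 0.
  apply: contraNeq e32 => z0; have zd0 := mulf_neq0 z0 dg0.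
  rewrite -(scalerK zd0 e3) memvZ //; move/eqP: E; rewrite addrC addr_eq0 => /eqP->.
  by rewrite memvN memvZ // memv_line.
move: E => /eqP; rewrite z0 mul0r scale0r addr0 scaler_eq0 (negPf e20) orbF.
by rewrite mulf_eq0 (negPf db0) orbF => /eqP->.
Qed.

End OrderSubplane.

Section SubplaneCoordinates.

Variables (L : finFieldType) (q : nat) (B : {set PG 2 L}).
Hypothesis q_gt1 : (1 < q)%N.
Hypothesis hB : order_subplane q B.

Variables e1 e2 e3 : 'rV[L]_3.
Hypothesis e_ind : forall x y z : L,
  x *: e1 + y *: e2 + z *: e3 = 0 -> [/\ x = 0, y = 0 & z = 0].

Definition pt (a : L * L * L) : 'rV[L]_3 :=
  a.1.1 *: e1 + a.1.2 *: e2 + a.2 *: e3.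

Definition comb k a l b : L * L * L :=
  (k * a.1.1 + l * b.1.1, k * a.1.2 + l * b.1.2, k * a.2 + l * b.2).

Definition det3 (a b c : L * L * L) : L :=
  a.1.1 * (b.1.2 * c.2 - b.2 * c.1.2) - a.1.2 * (b.1.1 * c.2 - b.2 * c.1.1)
  + a.2 * (b.1.1 * c.1.2 - b.1.2 * c.1.1).

Lemma pt_comb k a l b : pt (comb k a l b) = k *: pt a + l *: pt b.
Proof.
rewrite /pt /comb /= !scalerDr !scalerDl !scalerA.
rewrite [RHS]addrACA; congr (_ + _); rewrite [RHS]addrACA //.
Qed.

Lemma pt_inj : injective pt.
Proof.
move=> [[x y] z] [[x' y'] z'] E.
have : pt (comb 1 (x, y, z) (-1) (x', y', z')) = 0.
  by rewrite pt_comb E scale1r scaleN1r subrr.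
rewrite /pt /= => /e_ind[]; rewrite !mul1r !mulN1r.
by move=> /subr0_eq-> /subr0_eq-> /subr0_eq->.
Qed.

Lemma pt_line a b : pt a \in <[pt b]>%VS ->
  exists k, [/\ a.1.1 = k * b.1.1, a.1.2 = k * b.1.2 & a.2 = k * b.2].
Proof.
case/vlineP => k; have -> : k *: pt b = pt (comb k b 0 b).
  by rewrite pt_comb scale0r addr0.
by move/pt_inj ->; exists k; rewrite /= !mul0r !addr0.
Qed.

Lemma pt0 : pt (0, 0, 0) = 0.
Proof. by rewrite /pt /= !scale0r !addr0. Qed.

Lemma pt_neq0 a : a != (0, 0, 0) -> pt a != 0.
Proof. by apply: contra_neq; rewrite -pt0 => /pt_inj. Qed.

Lemma det3_indep a b c : det3 a b c != 0 ->
  pt b \notin <[pt a]>%VS /\ pt c \notin (<[pt a]> + <[pt b]>)%VS.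
Proof.
move=> D; split; [apply: contra D => /vlineP[k]|apply: contra D => /memv_line2[k [l]]].
  have -> : k *: pt a = pt (comb k a 0 a) by rewrite pt_comb scale0r addr0.
  by move/pt_inj->; apply/eqP; rewrite /det3 /=; ring.
by rewrite -pt_comb => /pt_inj->; apply/eqP; rewrite /det3 /=; ring.
Qed.

Definition inB (a : L * L * L) : bool := <[pt a]>%VS \in B.

(** The point [x] is on the join of [a], [b] and on that of [c], [d], which differ because [c] is
    off the first; so [meet_subline] applies. In the uses below the determinants are 1 or -1, and
    squaring covers both signs in a goal for [ring]. *)
Lemma inB_meet k l m n (a b c d x : L * L * L) :
    inB a -> inB b -> inB c -> inB d ->
    det3 a b c ^+ 2 = 1 -> det3 c d a ^+ 2 = 1 ->
    x = comb k a l b -> x = comb m c n d -> x != (0, 0, 0) ->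
  inB x.
Proof.
have sq1 (u : L) : u ^+ 2 = 1 -> u != 0.
  by move=> E; apply: contra_eq_neq E => ->; rewrite expr0n eq_sym oner_neq0.
move=> aB bB cB dB /sq1/det3_indep[ba cab] /sq1/det3_indep[dc _] xab xcd x0.
apply: (meet_subline hB (join_subline hB aB bB ba) (join_subline hB cB dB dc)).
- by apply: contraNneq cab => ->; rewrite memvE addvSl.
- exact: pt_neq0.
- by rewrite xab pt_comb memv_add // memvZ // memv_line.
- by rewrite xcd pt_comb memv_add // memvZ // memv_line.
Qed.

Hypothesis e1B : inB (1, 0, 0).
Hypothesis e2B : inB (0, 1, 0).
Hypothesis e3B : inB (0, 0, 1).
Hypothesis eB : inB (1, 1, 1).

(** These parametrise the points of [B] other than <e1> on the line joining <e1> and <e3>. *)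
Definition coords : {set L} := [set x | inB (x, 0, 1)].

Ltac meet_tac := first
  [ by rewrite /det3 /=; ring
  | by rewrite /comb /=; congr (_, _, _); ring
  | by rewrite !xpair_eqE ?oner_eq0 ?andbF ].

(** This point and the next two are the diagonal points of the quadrangle formed by the frame. *)
Lemma inB_011 : inB (0, 1, 1).
Proof. by apply: (@inB_meet (-1) 1 1 1 _ _ _ _ _ e1B eB e2B e3B); meet_tac. Qed.

Lemma inB_101 : inB (1, 0, 1).
Proof. by apply: (@inB_meet (-1) 1 1 1 _ _ _ _ _ e2B eB e1B e3B); meet_tac. Qed.

Lemma inB_110 : inB (1, 1, 0).
Proof. by apply: (@inB_meet (-1) 1 1 1 _ _ _ _ _ e3B eB e1B e2B); meet_tac. Qed.

(** Read (x, y, 1) as the affine point (x, y). Vertical lines pass through (0, 1, 0), horizontal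
    ones through (1, 0, 0), the diagonal through (1, 1, 0); intersecting such lines moves
    coordinates between the axes. *)
Lemma inB_diag x : inB (x, 0, 1) -> inB (x, x, 1).
Proof. by move=> xB; apply: (@inB_meet x 1 x 1 _ _ _ _ _ e2B xB inB_110 e3B); meet_tac. Qed.

Lemma inB_axis2 x : inB (x, 0, 1) -> inB (0, x, 1).
Proof.
by move=> /inB_diag xB; apply: (@inB_meet (- x) 1 x 1 _ _ _ _ _ e1B xB e2B e3B); meet_tac.
Qed.

Lemma inB_affine x y : inB (x, 0, 1) -> inB (y, 0, 1) -> inB (x, y, 1).
Proof.
by move=> xB /inB_axis2 yB; apply: (@inB_meet y 1 x 1 _ _ _ _ _ e2B xB e1B yB); meet_tac.
Qed.

Lemma inB_fst x y : inB (x, y, 1) -> inB (x, 0, 1).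
Proof. by move=> xB; apply: (@inB_meet (- y) 1 x 1 _ _ _ _ _ e2B xB e1B e3B); meet_tac. Qed.

Lemma inB_snd x y : inB (x, y, 1) -> inB (y, 0, 1).
Proof.
move=> xB; apply: (@inB_fst _ y).
by apply: (@inB_meet (y - x) 1 y 1 _ _ _ _ _ e1B xB inB_110 e3B); meet_tac.
Qed.

Lemma inB_slope m : inB (m, 0, 1) -> inB (1, m, 0).
Proof.
move=> /(inB_affine inB_101) mB.
by apply: (@inB_meet (-1) 1 m 1 _ _ _ _ _ e3B mB e2B e1B); meet_tac.
Qed.

(** The line of slope [m] through the origin meets the vertical line at [x] in (x, m x). *)
Lemma inB_mul x m : inB (x, 0, 1) -> inB (m, 0, 1) -> inB (m * x, 0, 1).
Proof.
move=> xB /inB_slope mB; apply: (@inB_snd x).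
by apply: (@inB_meet (m * x) 1 x 1 _ _ _ _ _ e2B xB mB e3B); meet_tac.
Qed.

Lemma axis1_subline : (<[e1]> + <[e3]>)%VS \in sublines B.
Proof.
have ptE1 : pt (1, 0, 0) = e1 by rewrite /pt /= scale1r !scale0r !addr0.
have ptE3 : pt (0, 0, 1) = e3 by rewrite /pt /= scale1r !scale0r !add0r.
rewrite -{1}ptE1 -ptE3; apply: (join_subline hB) => //.
rewrite ptE1 ptE3; apply/negP => /vlineP[k kE].
have [] := @e_ind (- k) 0 1; last by move=> _ _ /eqP; rewrite oner_eq0.
by rewrite scale1r scale0r addr0 kE scaleNr addNr.
Qed.

(** Of the q + 1 points of [B] on the line joining <e1> and <e3>, only <e1> is not of the form (x,
    0, 1). *)
Lemma card_coords : #|coords| = q.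
Proof.
have ptE1 : pt (1, 0, 0) = e1 by rewrite /pt /= scale1r !scale0r !addr0.
apply/eqP; rewrite -eqSS -(card_subline hB axis1_subline).
have fI : {in coords &, injective (fun x => <[pt (x, 0, 1)%R]>%VS)}.
  move=> x y _ _ E; have /pt_line[k [/= -> _]] : pt (x, 0, 1) \in <[pt (y, 0, 1)%R]>%VS.
    by rewrite -E memv_line.
  by rewrite mulr1 => <-; rewrite mul1r.
have -> : points_on B (<[e1]> + <[e3]>)%VS
    = <[e1]>%VS |: [set <[pt (x, 0, 1)%R]>%VS | x in coords].
  apply/setP => P; rewrite !inE; apply/idP/idP => [/andP[PB]|].
    have [p p0 PE] := subplane_point hB PB; subst P; rewrite -memvE => pE; move: (pE).
    case/memv_line2 => x [z pxz].
    have [z0|z0] := eqVneq z 0.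
      rewrite (@eq_vline _ _ p e1 p0) ?eqxx //= pxz z0 scale0r addr0.
      by rewrite memvZ // memv_line.
    have E : <[p]>%VS = <[pt (x / z, 0, 1)%R]>%VS.
      apply: eq_vline => //; rewrite pxz; apply/vlineP; exists z.
      rewrite /pt /= scale0r addr0 scale1r scalerDr scalerA.
      by rewrite mulrC divfK.
    apply/orP; right; apply/imsetP; exists (x / z) => //.
    by rewrite inE /inB -E.
  have e1E : <[e1]>%VS \in B by rewrite -ptE1.
  move=> /orP[/eqP->|/imsetP[x]]; first by rewrite e1E addvSl.
  rewrite inE /inB => xB ->; rewrite xB -memvE /pt /= scale0r addr0 scale1r.
  by rewrite memv_add ?memvZ // memv_line.
rewrite cardsU1 card_in_imset // -add1n eqn_add2r eq_sym eqb1.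
apply/imsetP => -[x _ E].
have /pt_line[k [_ _ /eqP]] : pt (x, 0, 1) \in <[pt (1, 0, 0)%R]>%VS.
  by rewrite ptE1 E memv_line.
by rewrite /= mulr0 oner_eq0.
Qed.

Variables (F : finFieldType) (s : {rmorphism F -> L}).
Hypothesis cardF : #|F| = q.

(* The coordinates in the frame form a multiplicatively closed set of size q
   containing 0, so they are the roots of X^q - X, as are the elements of F. *)
Lemma mem_coords x : inB (x, 0, 1) = (x \in codom s).
Proof.
have sub : {subset coords <= codom s}.
  move=> y yD; apply: mem_rmorph_fixed; rewrite cardF -card_coords.
  apply: expf_card_stable => //; first by rewrite inE.
  by move=> a b; rewrite !inE => aD bD; apply: inB_mul.
have : coords =i codom s.
  apply/subset_cardP; last exact/subsetP.
  by rewrite card_coords card_codom ?cardF //; apply: fmorph_inj.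
by move=> <-; rewrite inE.
Qed.

Variable linf : PG 2 L.
Hypothesis linf_dim : \dim linf = 2.
Hypothesis linf_tangent : points_on B linf = [set <[e1]>%VS].

(** The vector [e0] spans the point of [linf] on the line joining <e2> and <e3>, scaled to (0, eta,
    1); tangency keeps it out of [B], hence [eta] out of F. Other points of [linf] than <e1> are of
    the form (x / t, eta, 1). A subline through such a point contains some (b, 0, 1) and (c, 1, 1)
    with [b], [c] in F, so x / t = b + (c - b) eta; conversely, such points can be joined. *)
Lemma splash_slopes : exists e0 eta,
  [/\ linf = (<[e1]> + <[e0]>)%VS, eta \notin codom s
    & forall x t, x *: e1 + t *: e0 != 0 ->
        <[x *: e1 + t *: e0]>%VS \in splash linf B <->
        t = 0 \/ slope s eta (x / t)].
Proof.
have ptE1 : pt (1, 0, 0) = e1 by rewrite /pt /= scale1r !scale0r !addr0.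
have ptE2 : pt (0, 1, 0) = e2 by rewrite /pt /= scale1r !scale0r add0r addr0.
have ptE3 : pt (0, 0, 1) = e3 by rewrite /pt /= scale1r !scale0r !add0r.
have on_linf a : inB a -> pt a \in linf -> pt a \in <[e1]>%VS.
  rewrite /inB memvE => aB al; have : <[pt a]>%VS \in points_on B linf by rewrite inE aB.
  by rewrite linf_tangent => /set1P <-; rewrite memv_line.
have e1_pt a : pt a \in <[e1]>%VS -> a.1.2 = 0 /\ a.2 = 0.
  by rewrite -ptE1 => /pt_line[k [_ -> ->]]; rewrite !mulr0.
have e1l : e1 \in linf.
  by have := set11 <[e1]>%VS; rewrite -linf_tangent inE memvE => /andP[].
have e10 : e1 != 0 by rewrite -ptE1; apply: pt_neq0; rewrite !xpair_eqE oner_eq0.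
have e1n a : (a.1.2 != 0) || (a.2 != 0) -> pt a \notin <[e1]>%VS.
  by apply: contraL => /e1_pt[-> ->]; rewrite eqxx.
have e2_0 : e2 \notin <[e1]>%VS by rewrite -ptE2 e1n //= oner_eq0.
have e3_2 : e3 \notin <[e2]>%VS.
  apply/negP; rewrite -ptE2 -ptE3 => /pt_line[k [_ _ /eqP]].
  by rewrite /= mulr0 oner_eq0.
have d23 : \dim (<[e2]> + <[e3]>) = 2%N.
  by rewrite dimv_add_line // dim_vline; case: eqP e2_0 => [->|//]; rewrite mem0v.
have [v v0 /andP[vl /memv_line2[y [z vE]]]] := lines_meet linf_dim d23.
(* Otherwise [linf] would contain <e2>, a second point of [B]. *)
have z0 : z != 0.
  apply: contraNneq e2_0 => z0; rewrite vE z0 scale0r addr0 in v0 vl.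
  have y0 : y != 0 by apply: contraNneq v0 => ->; rewrite scale0r.
  by rewrite -ptE2 on_linf // ptE2 -(scalerK y0 e2) memvZ.
pose eta := y / z; pose e0 := eta *: e2 + e3.
have e0E : e0 = z^-1 *: v.
  by rewrite vE scalerDr !scalerA mulVf // scale1r mulrC.
have e0l : e0 \in linf by rewrite e0E memvZ.
have ptE0 : e0 = pt (0, eta, 1) by rewrite /pt /= scale0r add0r scale1r.
have e0_1 : e0 \notin <[e1]>%VS by rewrite ptE0 e1n //= oner_eq0 orbT.
have linfE : linf = (<[e1]> + <[e0]>)%VS.
  by apply: addv_line_eq => //; rewrite -?memvE // linf_dim dim_vline e10.
have X_pt x t : x *: e1 + t *: e0 = pt (x, t * eta, t).
  by rewrite /pt /= /e0 scalerDr scalerA addrA.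
exists e0, eta; split => //.
  apply: contra e0_1; rewrite -mem_coords => etaB.
  by rewrite ptE0; apply: on_linf; [apply: inB_axis2|rewrite -ptE0].
move=> x t xt0; rewrite inE (line_in_points xt0) /=.
have -> : (<[x *: e1 + t *: e0]> <= linf)%VS.
  by rewrite -memvE linfE memv_add // memvZ // memv_line.
split=> /= [/existsP[m /andP[mB Xm]]|xW]; last first.
  apply/existsP; have [t0|t0] := eqVneq t 0.
    exists (<[e1]> + <[e3]>)%VS; rewrite axis1_subline t0 scale0r addr0.
    by rewrite -memvE memvZ // memvE addvSl.
  case: xW => [/eqP|[a [b E]]]; first by rewrite (negPf t0).
  have aB : inB (s a, 0, 1) by rewrite mem_coords codom_f.
  have cB : inB (s (a + b), 1, 1).
    by apply: inB_affine inB_101; rewrite mem_coords codom_f.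
  exists (<[pt (s a, 0%R, 1%R)%R]> + <[pt (s (a + b), 1%R, 1%R)%R]>)%VS.
  apply/andP; split.
    apply: (join_subline hB) => //; apply/negP => /pt_line[k [_ /eqP]].
    by rewrite /= mulr0 oner_eq0.
  rewrite -memvE X_pt.
  have -> : (x, t * eta, t) = comb (t * (1 - eta)) (s a, 0, 1) (t * eta) (s (a + b), 1, 1).
    rewrite /comb /= rmorphD; congr (_, _, _); [|ring|ring].
    by rewrite -[x](divfK t0) E; ring.
  by rewrite pt_comb memv_add // memvZ // memv_line.
have [->|t0] := eqVneq t 0; [by left|right].
rewrite -memvE in Xm.
have xm : pt (x / t, eta, 1) \in m.
  have -> : pt (x / t, eta, 1) = t^-1 *: (x *: e1 + t *: e0).
    rewrite X_pt; have -> : (x / t, eta, 1) = comb t^-1 (x, t * eta, t) 0 (0, 0, 0).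
      by rewrite /comb /=; congr (_, _, _); field.
    by rewrite pt_comb scale0r addr0.
  by rewrite memvZ.
have dm := subline_dim mB.
(* A subline through <e1> and a second point of [linf] would be [linf], which has one point of [B]
   instead of q + 1. *)
have e1m : e1 \notin m.
  apply/negP => e1m.
  have X_1 : x *: e1 + t *: e0 \notin <[e1]>%VS by rewrite X_pt e1n //= t0 orbT.
  have lE m' : \dim m' = 2 -> e1 \in m' -> x *: e1 + t *: e0 \in m' ->
      m' = (<[e1]> + <[x *: e1 + t *: e0]>)%VS.
    by move=> dm' em' Xm'; apply: addv_line_eq; rewrite -?memvE ?dm' ?dim_vline ?e10.
  have mE : m = linf.
    rewrite (lE m dm e1m Xm) -(lE linf linf_dim e1l) //.
    by rewrite memvD // memvZ.
  have := card_subline hB mB; rewrite mE linf_tangent cards1 => -[qE].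
  by move: q_gt1; rewrite -qE.
have meet_m a b : inB a -> inB b -> pt b \notin <[pt a]>%VS -> e1 \in (<[pt a]> + <[pt b]>)%VS ->
    exists k l, pt (comb k a l b) \in m /\ inB (comb k a l b).
  move=> aB bB ba e1ab; have abB := join_subline hB aB bB ba.
  have [u u0 /andP[um uab]] := lines_meet dm (subline_dim abB).
  have mab : m != (<[pt a]> + <[pt b]>)%VS by apply: contraNneq e1m => ->.
  have uB := meet_subline hB mB abB mab u0 um uab.
  have [k [l uE]] := memv_line2 uab; rewrite -pt_comb in uE.
  by exists k, l; rewrite /inB -uE.
have meet_row y1 : inB (0, y1, 1) -> exists2 b, inB (b, y1, 1) & pt (b, y1, 1) \in m.
  move=> yB; have [||k [l [um uB]]] := meet_m (1, 0, 0) (0, y1, 1) e1B yB.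
  - by rewrite ptE1 e1n //= oner_eq0 orbT.
  - by rewrite ptE1 memvE addvSl.
  have l0 : l != 0.
    apply: contraNneq e1m => l0; rewrite l0 pt_comb scale0r addr0 ptE1 in um.
    have k0 : k != 0.
      apply: contraTneq uB => k0; rewrite /inB l0 k0 pt_comb !scale0r addr0.
      by apply/negP => /(subplane_neq0 hB); rewrite eqxx.
    by rewrite -(scalerK k0 e1) memvZ.
  have bE : pt (k / l, y1, 1) = l^-1 *: pt (comb k (1, 0, 0) l (0, y1, 1)).
    have -> : (k / l, y1, 1) = comb l^-1 (comb k (1, 0, 0) l (0, y1, 1)) 0 (0, 0, 0).
      by rewrite /comb /=; congr (_, _, _); field.
    by rewrite pt_comb scale0r addr0.
  exists (k / l); last by rewrite bE memvZ.
  rewrite /inB bE (@eq_vline _ _ _ (pt (comb k (1, 0, 0) l (0, y1, 1)))) //.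
    by rewrite -bE pt_neq0 // !xpair_eqE oner_eq0 andbF.
  by rewrite memvZ // memv_line.
have [b bB bm] := meet_row 0 e3B; have [c cB cm] := meet_row 1 inB_011.
have /codomP[b' bE] : b \in codom s by rewrite -mem_coords.
have /codomP[c' cE] : c \in codom s by rewrite -mem_coords (inB_fst cB).
(* A difference of two vectors of [m] with the same last two coordinates is a multiple of [e1]; as
   [e1] is off [m], the scalar must be 0. *)
have : (x / t - (b + (c - b) * eta)) *: e1 \in m.
  have -> : (x / t - (b + (c - b) * eta)) *: e1
      = pt (x / t, eta, 1) - ((1 - eta) *: pt (b, 0, 1) + eta *: pt (c, 1, 1)).
    rewrite -pt_comb -[pt _ as X in X - _]scale1r -scaleN1r -pt_comb -[e1 in LHS]ptE1.
    rewrite -[LHS]addr0 -(scale0r (pt (0, 0, 0))) -pt_comb; congr pt.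
    by rewrite /comb /=; congr (_, _, _); ring.
  by rewrite memvB // memvD // memvZ.
have [E _|d0] := eqVneq (x / t - (b + (c - b) * eta)) 0.
  exists b', (c' - b'); rewrite rmorphB -bE -cE.
  by move: E => /subr0_eq.
by move=> em; case/negP: e1m; rewrite -(scalerK d0 e1) memvZ.
Qed.

End SubplaneCoordinates.

(** * Lines meeting the splash planes, and the theorem *)

Lemma meetsP n (K : finFieldType) (U W : PG n K) :
  reflect (exists v, [/\ v != 0, v \in U & v \in W]) (meets U W).
Proof.
apply: (iffP idP) => [UW|[v [v0 vU vW]]].
  exists (vpick (U :&: W)%VS); rewrite vpick0.
  by have := memv_pick (U :&: W)%VS; rewrite memv_cap => /andP[-> ->].
apply: contraNneq v0 => UW; have : v \in (U :&: W)%VS by rewrite memv_cap vU.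
by rewrite UW memv0.
Qed.

(* A line has |K| + 1 points, so it meets |K| + 1 pairwise disjoint subspaces
   only if each of them contains exactly one of its points. *)
Lemma line_meeting_all n (K : finFieldType) (l : PG n K) (A : {set PG n K}) :
    \dim l = 2 -> #|A| = #|K|.+1 -> {in A, forall U, meets l U} ->
    {in A &, forall (U U' : PG n K) (v : 'rV[K]_n.+1), v != 0 -> v \in U -> v \in U' -> U = U'} ->
  {in l, forall v, v != 0 -> exists2 U, U \in A & v \in U} /\
  {in A, forall U : PG n K, {in l &, forall v v', v != 0 -> v \in U -> v' \in U ->
     v' \in <[v]>%VS}}.
Proof.
move=> dl cA Al Adisj.
have [|v1 v1l] := @memv_notin_lt _ _ 0%VS l; first by rewrite dimv0 dl.
rewrite memv0 => v10; have [|v2 v2l v21] := @memv_notin_lt _ _ <[v1]>%VS l.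
  by rewrite dl dim_vline v10.
have lE : l = (<[v1]> + <[v2]>)%VS.
  by apply: addv_line_eq; rewrite -?memvE // dl dim_vline v10.
(* The values of [h] represent the #|K| + 1 points of [l]. *)
pose h (o : option K) := if o is Some a then a *: v1 + v2 else v1.
have h0 o : h o != 0.
  case: o => [a|] //=; apply: contraNneq v21 => /eqP.
  by rewrite addrC addr_eq0 => /eqP->; rewrite memvN memvZ // memv_line.
have hP v : v \in l -> v != 0 -> exists o c, c != 0 /\ v = c *: h o.
  rewrite lE => /memv_line2[a [b ->]]; have [->|b0 _] := eqVneq b 0.
    rewrite scale0r addr0 => av0; exists None, a; split=> //.
    by apply: contraNneq av0 => ->; rewrite scale0r.
  by exists (Some (a / b)), b; rewrite /= scalerDr scalerA mulrC divfK.
(* Each point is sent to the element of [A] through it, if any. All of [A] is reached, so by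
   counting [k] is injective and never [None]. *)
pose k o := [pick U in A | h o \in U].
have kP o U : U \in A -> h o \in U -> k o = Some U.
  move=> UA oU; rewrite /k; case: pickP => [U' /andP[U'A oU']|H].
    by congr Some; apply: Adisj oU' oU.
  by have := H U; rewrite UA oU.
have sub : Some @: A \subset k @: setT.
  apply/subsetP => _ /imsetP[U UA ->]; have /meetsP[v [v0 vl vU]] := Al U UA.
  have [o [c [c0 vE]]] := hP v vl v0.
  apply/imsetP; exists o => //; rewrite (kP o U) //.
  by rewrite -(scalerK c0 (h o)) -vE memvZ.
have SomeI : injective (@Some (PG n K)) by move=> ? ? [].
have cle : (#|k @: setT| <= #|Some @: A|)%N.
  by rewrite (card_imset _ SomeI) cA (leq_trans (leq_imset_card _ _)) // cardsT card_option.
have kE : Some @: A = k @: setT by apply/eqP; rewrite eqEcard sub.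
have kI : {in setT &, injective k}.
  by apply/imset_injP; rewrite -kE (card_imset _ SomeI) cA cardsT card_option.
split=> [v vl v0|U UA v v' vl v'l v0 vU v'U].
  have [o [c [c0 ->]]] := hP v vl v0.
  have : k o \in Some @: A by rewrite kE imset_f.
  case/imsetP => U UA; rewrite /k; case: pickP => // U' /andP[U'A oU'] _.
  by exists U' => //; rewrite memvZ.
have [->|v'0] := eqVneq v' 0; first exact: mem0v.
have inU w (o : option K) (c : K) : c != 0 -> w \in U -> w = c *: h o -> k o = Some U.
  by move=> c0 wU wE; apply: kP => //; rewrite -(scalerK c0 (h o)) -wE memvZ.
have [o [c [c0 vE]]] := hP v vl v0; have [o' [c' [c'0 v'E]]] := hP v' v'l v'0.
have oo' : o = o' by apply: kI; rewrite ?inE // (inU v o c) // (inU v' o' c').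
rewrite -{}oo' in v'E.
by rewrite v'E -(scalerK c0 (h o)) -vE !memvZ // memv_line.
Qed.

Local Close Scope ring_scope.

(* For q = 2 the uniqueness part fails: every line meeting 3 of the 5 planes
   then lies in 3 cover planes. Existence is asserted for every q. *)
Theorem theorem9p5 (q : nat) (F L : finFieldType)
    (cardF : #|F| = q) (cardL : #|L| = q ^ 3)
    (Sigma : PG 6 F) (hSigma : Sigma \in hyperplanes)
    (S : {set PG 6 F}) (regS : regular_2spread Sigma S)
    (linf : PG 2 L) (hlinf : linf \in lines)
    (phi psi : PG 2 L -> PG 6 F) (hBB : bruck_bose Sigma S linf phi psi)
    (T : PG 2 L) (ST : {set PG 2 L}) (hST : tangent_splash q linf T ST)
    (l : PG 6 F) (hl : l \in lines) (lSigma : (l <= Sigma)%VS)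
    (hlST : #|[set U in [set phi X | X in ST] | meets l U]| = q.+1) :
  exists P : PG 6 F,
    [/\ cover_plane Sigma [set phi X | X in ST] P,
        (l <= P)%VS
      & 2 < q ->
        forall P' : PG 6 F,
          cover_plane Sigma [set phi X | X in ST] P' -> (l <= P')%VS -> P' = P].
Proof.
Local Open Scope ring_scope.
have q_gt1 : (1 < q)%N by rewrite -cardF finNzRing_gt1.
have [spreadS _] := regS.
have [B [hB BT STE]] := hST.
have TB : T \in B by have := set11 T; rewrite -BT inE => /andP[].
have [e1 [e2 [e3 [TE [e1B e2B e3B eB] e_ind]]]] := frame_at q_gt1 hB TB.
subst T; have dlinf := linf_dim hlinf.
have [|o _ ol] := @memv_notin_lt _ _ linf fullv; first by rewrite dlinf dimvf.
have [s [g [gD gZ gI [gS gonto] phiP]]] :=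
  bruck_bose_semilinear hSigma spreadS hlinf hBB ol.
have inB1 x y z : <[x *: e1 + y *: e2 + z *: e3]>%VS \in B -> inB B e1 e2 e3 (x, y, z) by [].
have [||||e0 [eta [linfE etaF splashP]]] :=
    @splash_slopes L q B q_gt1 hB e1 e2 e3 e_ind _ _ _ _ F s cardF linf dlinf BT.
- by apply: inB1; rewrite scale1r !scale0r !addr0.
- by apply: inB1; rewrite scale1r !scale0r addr0 add0r.
- by apply: inB1; rewrite scale1r !scale0r !add0r.
- by apply: inB1; rewrite !scale1r.
pose vec (x t : L) := x *: e1 + t *: e0.
have vec_linf x t : vec x t \in linf.
  by rewrite linfE memv_add // memvZ // memv_line.
have vecE v : v \in linf -> exists x t, v = vec x t by rewrite linfE => /memv_line2.
have not_line v : (linf <= <[v]>)%VS -> False.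
  by move=> /dimvS; rewrite dlinf dim_vline; case: (v != 0).
have vec0 x t : vec x t = 0 -> x = 0 /\ t = 0.
  rewrite /vec; have [->|x0] := eqVneq x 0.
    rewrite scale0r add0r => /eqP; rewrite scaler_eq0 => /orP[/eqP->//|/eqP e00].
    by case: (not_line e1); rewrite linfE e00 subv_add subvv -memvE mem0v.
  move=> /eqP; rewrite addr_eq0 => /eqP E; case: (not_line e0).
  rewrite linfE subv_add subvv andbT -memvE -(scalerK x0 e1) E.
  by rewrite memvZ // memvN memvZ // memv_line.
have vecZ c x t : c *: vec x t = vec (c * x) (c * t).
  by rewrite /vec scalerDr !scalerA.
have vecI x t x' t' : vec x t = vec x' t' -> x = x' /\ t = t'.
  move=> /eqP; rewrite -subr_eq0 /vec opprD addrACA -!scalerBl => /eqP/vec0[].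
  by move=> /subr0_eq-> /subr0_eq->.
have vec_neq0 x t : (x != 0) || (t != 0) -> vec x t != 0.
  by apply: contraL => /eqP/vec0[-> ->]; rewrite eqxx.
pose G x t := g (vec x t).
have g0 : g 0 = 0.
  by apply: (addrI (g 0)); rewrite -gD ?mem0v // !addr0.
have GD x t x' t' : G (x + x') (t + t') = G x t + G x' t'.
  by rewrite /G -gD ?vec_linf // /vec !scalerDl addrACA.
have GZ a x t : G (s a * x) (s a * t) = a *: G x t.
  by rewrite /G -vecZ gZ ?vec_linf.
have GI x t x' t' : G x t = G x' t' -> x = x' /\ t = t'.
  by move=> /gI E; apply/vecI/E.
have GS x t : G x t \in Sigma by apply: gS.
have Gonto v : v \in Sigma -> exists x t, v = G x t.
  by move=> /gonto[y /vecE[x [t ->]] ->]; exists x, t.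
have G_neq0 x t : (x != 0) || (t != 0) -> G x t != 0.
  move=> /vec_neq0; apply: contra_neq => E; apply: gI; rewrite ?mem0v //.
  by rewrite g0.
have phiG x t v : vec x t != 0 ->
    v \in phi <[vec x t]>%VS <-> exists c, v = G (c * x) (c * t).
  move=> xt0; rewrite (phiP _ (vec_linf x t) v xt0).
  by split=> -[c ->]; exists c; rewrite /G -vecZ.
have STP X : X \in ST -> exists x t,
    [/\ vec x t != 0, X = <[vec x t]>%VS & t = 0 \/ slope s eta (x / t)].
  rewrite STE => XS; move: (XS); rewrite !inE => /andP[/eqP/dimv1_line[v v0 XE]].
  rewrite XE -memvE => /andP[/vecE[x [t vE]] _]; rewrite vE in v0 XE.
  exists x, t; split; rewrite ?vE //.
  by apply: (iffLR (splashP x t v0)); rewrite -[_ + _]/(vec x t) -XE.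
have ST_S X : X \in ST -> phi X \in S.
  rewrite STE inE => /and3P[Xp Xl _].
  exact: (phi_at_infinity hlinf hBB).
pose A := [set U in [set phi X | X in ST] | meets l U].
have dl : \dim l = 2 by move: hl; rewrite inE => /eqP.
have [||| l_on l_sc] := @line_meeting_all _ _ l A dl.
- by rewrite hlST cardF.
- by move=> U; rewrite inE => /andP[].
- move=> U U'; rewrite !inE => /andP[/imsetP[X XS ->] _] /andP[/imsetP[X' X'S ->] _] v.
  by apply: (spread_plane_eq spreadS); apply: ST_S.
(* By [l_on] the vector lies in a plane phi X of [A]; injectivity of [g] puts [vec x t] on X, so X =
   <vec x t> belongs to the splash. *)
have l_splash x t : G x t \in l -> G x t != 0 ->
    (t = 0 \/ slope s eta (x / t)) /\ phi <[vec x t]>%VS \in A.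
  move=> xl xt0; have [U UA xU] := l_on _ xl xt0.
  have v0 : vec x t != 0 by apply: contraNneq xt0 => E; rewrite /G E g0.
  move: (UA); rewrite inE => /andP[/imsetP[X XS UE] _]; rewrite {}UE in UA xU.
  have [x' [t' [v'0 XE _]]] := STP X XS; rewrite {}XE in XS UA xU.
  have [c] := (iffLR (phiG _ _ _ v'0)) xU.
  rewrite /G -vecZ => /gI E; have {}E := E (vec_linf _ _) (memvZ _ (vec_linf _ _)).
  have XE : <[vec x t]>%VS = <[vec x' t']>%VS.
    by apply: eq_vline => //; rewrite E memvZ // memv_line.
  rewrite XE; split=> //; apply: (iffLR (splashP x t v0)).
  by rewrite -[_ + _]/(vec x t) XE -STE.
have cardL' : #|L| = (#|F| ^ 3)%N by rewrite cardF.
have [||P [[dP PS [Pinf Pcov]] lP Puniq]] :=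
    unique_cover_through_line cardL' etaF GD GZ GI GS Gonto dl lSigma.
- move=> x t xl t0; have Gn0 : G x t != 0 by rewrite G_neq0 // t0 orbT.
  by have [[/eqP|//]] := l_splash x t xl Gn0; rewrite (negPf t0).
(* Proportional coordinates put both vectors in the plane phi <vec x t> of [A], which [l] meets in a
   single point by [l_sc]. *)
- move=> x t x' t' xl x'l xt0 E; have [_ UA] := l_splash x t xl xt0.
  have v0 : vec x t != 0 by apply: contraNneq xt0 => E0; rewrite /G E0 g0.
  apply: (l_sc _ UA) => //; apply: (iffRL (phiG x t _ v0)); first by exists 1; rewrite !mul1r.
  have [t0|t0] := eqVneq t 0; last first.
    by exists (t' / t); rewrite divfK //; congr G; rewrite mulrAC -[t' * x]mulrC E mulfK.
  have x0 : x != 0.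
    by apply: contraNneq xt0 => x0; rewrite x0 t0 /G /vec !scale0r addr0 g0.
  move/eqP: E; rewrite t0 mulr0 mulf_eq0 (negPf x0) => /eqP t'0.
  by exists (x' / x); rewrite t'0 mulr0 divfK.
(* Through [phiG], the witnesses here rewrite a vector of slope x / t as a multiple of (x, t). *)
have cover_of P' : P' \in planes_of Sigma -> covers s eta G P' ->
    cover_plane Sigma [set phi X | X in ST] P'.
  move=> P'p [[c c0 cP] covP']; split=> // U /imsetP[X XS ->]; apply/meetsP.
  have [x [t [v0 -> xt]]] := STP X XS.
  have [t0|t0] := eqVneq t 0.
    have x0 : x != 0 by apply: contraNneq v0 => x0; rewrite x0 t0 /vec !scale0r addr0.
    exists (G c 0); split=> //; first by rewrite G_neq0 ?c0.
    by apply: (iffRL (phiG x t _ v0)); exists (c / x); rewrite t0 mulr0 divfK.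
  case: xt => [/eqP|xt]; first by rewrite (negPf t0).
  have [d d0 dP'] := covP' _ xt; exists (G (x / t * d) d); split=> //.
    by rewrite G_neq0 // d0 orbT.
  by apply: (iffRL (phiG x t _ v0)); exists (d / t); rewrite divfK //; congr G; ring.
have covers_of P' : cover_plane Sigma [set phi X | X in ST] P' -> covers s eta G P'.
  move=> [_ covP']; have covG x t : (x != 0) || (t != 0) -> t = 0 \/ slope s eta (x / t) ->
      exists2 c, c != 0 & G (c * x) (c * t) \in P'.
    move=> /vec_neq0 v0 xt; have XS : <[vec x t]>%VS \in ST.
      by rewrite STE; apply: (iffRL (splashP x t v0)).
    have /meetsP[v [v_0 vP /(phiG _ _ _ v0)[c vE]]] := covP' _ (imset_f phi XS).
    exists c; last by rewrite -vE.
    by apply: contraNneq v_0 => c0; rewrite vE c0 !mul0r /G /vec !scale0r addr0 g0.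
  split=> [|w wW].
    have [||c c0] := covG 1 0; [by rewrite oner_eq0|by left|].
    by rewrite mulr1 mulr0; exists c.
  have [||c c0] := covG w 1; first by rewrite oner_eq0 orbT.
    by right; rewrite divr1.
  by rewrite mulr1 mulrC; exists c.
exists P; split=> //.
  by apply: cover_of => //; rewrite !inE dP PS.
rewrite -cardF => F2 P' covP' lP'; have [P'p _] := covP'.
move: P'p; rewrite !inE => /andP[/eqP dP' P'S].
by apply: Puniq => //; apply: covers_of.
Qed.
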